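(* Let $t$ be a topological rooted tree, and let $W_t=W_{\Gamma_t}$ be the Kontsevich weight of the associated Kontsevich tree $\Gamma_t$. Then $$W_t=I_t(0),$$ where the functions $I_t(\theta)$, $\theta\in[0,1)$, are defined recursively by $I_\bullet(\theta)=\frac12-\theta$ and, for $t=[t_1,\dots,t_m]$, $$I_t(\theta)=\int_0^1d\bar\lambda\int_\theta^{\bar\lambda}d\bar\theta\;I_{t_1}(\bar\theta)\cdots I_{t_m}(\bar\theta).$$
   Context: A topological rooted tree is an isomorphism class of (nonempty, finite) rooted trees, with edges oriented toward the root; $\bullet$ is the one-vertex tree and $[t_1,\dots,t_m]$ is the tree obtained by grafting the roots of $t_1,\dots,t_m$ onto a new root; $|t|$ is the number of vertices. The graph $\Gamma_t$: let $n=|t|$ and label the vertices of $t$ by $1,\dots,n$ (the weight does not depend on the labelling). $\Gamma_t$ has aerial vertices $1,\dots,n$ and two terrestrial vertices $\bar1,\bar2$. From each aerial vertex $k$ start two ordered edges $e_k^1$ (first) and $e_k^2$ (second): $e_k^1$ ends at $\bar1$ for every $k$; if $k$ is not the root, $e_k^2$ ends at the parent of $k$ in $t$ (the next vertex toward the root); if $k$ is the root, $e_k^2$ ends at $\bar2$. The weight: for $p$ in the open upper half plane $\mathcal H$ and $q\in\mathcal H\cup\mathbb{R}$, $q\neq p$, let $\phi(p,q)=\frac1{2\pi}\arg\frac{q-p}{q-\bar p}\in[0,1)$ (here $\bar p$ is the complex conjugate). A configuration is a tuple $(z_1,\dots,z_n)$ of distinct points of $\mathcal H$, with $z_k$ assigned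 to the aerial vertex $k$ and $0,1$ assigned to $\bar1,\bar2$. $M_n$ is the manifold of configurations, with the orientation induced by the standard one of $\mathcal H^n\subset\mathbb{C}^n$, and $\bar M_n$ is Kontsevich's compactification (a manifold with corners with interior $M_n$). With $\phi_k^i=\phi(z_k,z_v)$, where $v$ is the target of $e_k^i$, put $$\omega_{\Gamma}=\bigwedge_{k=1}^n d\phi_k^1\wedge d\phi_k^2,\qquad W_{\Gamma}=\int_{\bar M_n}\omega_{\Gamma}$$ (no factor $1/n!$). *)

(* Defs.v *)
From HB Require Import structures.
From mathcomp Require Import all_boot all_order all_algebra.
From mathcomp Require Import complex ring.
From mathcomp Require Import all_classical all_reals all_analysis.

Set Implicit Arguments.
Unset Strict Implicit.
Unset Printing Implicit Defensive.

Import Order.TTheory GRing.Theory Num.Theory.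
Import numFieldNormedType.Exports.

Local Open Scope classical_set_scope.
Local Open Scope ring_scope.

(* A term is a planar representative [t_1, ..., t_m] of a topological rooted
   tree: two terms stand for the same topological tree when they differ by the
   order of the children.  The one-vertex tree is [RNode [::]]. *)
Inductive rtree : Type := RNode of seq rtree.

(* A rooted tree with vertex set 'I_n, given by its parent map ([None] only at
   the root); the edges are oriented toward the root [r]. *)
Definition rooted_tree n (par : 'I_n -> option 'I_n) (r : 'I_n) : Prop :=
  par r = None /\
  forall k, exists m, iter m (obind par) (Some k) = Some r.

(* [has_shape par v t]: the subtree of descendants of [v] is a representative
   of the topological rooted tree [t].  The children of [v] may be enumerated
   in any order, so this does not depend on the planar structure of [t]. *)
Inductive has_shape n (par : 'I_n -> option 'I_n) : 'I_n -> rtree -> Prop :=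
| HasShape (v : 'I_n) (cs : seq 'I_n) (ts : seq rtree) of
    perm_eq cs [seq c <- enum 'I_n | par c == Some v] &
    size cs = size ts &
    (forall i, (i < size ts)%N ->
       has_shape par (nth v cs i) (nth (RNode [::]) ts i)) :
    has_shape par v (RNode ts).

Inductive kvertex n : Type := Aerial of 'I_n | Bar1 | Bar2.
Arguments Bar1 {n}.
Arguments Bar2 {n}.

(* [G k i] is the target of the (i+1)-st edge starting at the aerial vertex k *)
Definition kgraph n := 'I_n -> 'I_2 -> kvertex n.

Definition ktree n (par : 'I_n -> option 'I_n) : kgraph n :=
  fun k i => if i == 0 then Bar1
             else if par k is Some j then Aerial j else Bar2.

Definition arg (R : realType) (w : R[i]) : R :=
  let a := acos (complex.Re w / complex.Re `|w|) in
  if 0 <= complex.Im w then a else pi *+ 2 - a.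

Lemma argP (R : realType) (w : R[i]) : w != 0 ->
  0 <= arg w < pi *+ 2 /\ w = `|w| * Complex (cos (arg w)) (sin (arg w)).
Proof.
case: w => a b w0; rewrite /arg normc_def /=.
set n := Num.sqrt _.
have n2 : n ^+ 2 = a ^+ 2 + b ^+ 2 by rewrite sqr_sqrtr // addr_ge0 ?sqr_ge0.
have n0 : 0 < n.
  rewrite lt_neqAle sqrtr_ge0 andbT eq_sym; apply: contraNneq w0 => n0.
  move: n2; rewrite n0 expr0n /= => /esym/eqP.
  rewrite paddr_eq0 ?sqr_ge0 // !sqrf_eq0 => /andP[/eqP-> /eqP->].
  by [].
have an : -1 <= a / n <= 1.
  rewrite -ler_norml normrM normfV (gtr0_norm n0) ler_pdivrMr // mul1r.
  by rewrite -(@ler_pXn2r _ 2) ?nnegrE ?(ltW n0)// real_normK ?num_real// n2 lerDl sqr_ge0.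
have s2 : Num.sqrt (1 - (a / n) ^+ 2) = `|b| / n.
  have -> : 1 - (a / n) ^+ 2 = (`|b| / n) ^+ 2.
    rewrite !exprMn real_normK ?num_real//.
    have -> : b ^+ 2 = n ^+ 2 - a ^+ 2 by rewrite n2 addrC addKr.
    by field; rewrite lt0r_neq0.
  by rewrite sqrtr_sqr ger0_norm // divr_ge0 // ltW.
have ca := acosK an.
have sa : sin (acos (a / n)) = `|b| / n by rewrite sin_acos// s2.
have a0 := acos_ge0 an. have api := acos_lepi an.
have pi0 := pi_gt0 R.
have nn : n != 0 by rewrite lt0r_neq0.
case: ifPn => b0; split.
- rewrite a0 /=. apply: le_lt_trans api _. by rewrite mulr2n ltrDl.
- rewrite ca sa ger0_norm //. by apply/eqP; rewrite eq_complex /= !mul0r subr0 addr0 ![n * _]mulrC !divfK// !eqxx.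
- rewrite -ltNge in b0.
  have : 0 < acos (a / n).
    rewrite lt_neqAle a0 andbT eq_sym; apply/negP => /eqP e.
    move: sa; rewrite e sin0 => /esym/eqP; rewrite mulf_eq0 invr_eq0 (negPf nn) orbF normr_eq0.
    by rewrite (lt_eqF b0).
  move=> a1. rewrite ltrBlDr ltrDl a1 andbT subr_ge0. apply: le_trans api _.
  by rewrite mulr2n lerDl ltW.
- rewrite -ltNge in b0.
  rewrite addrC cosD2pi sinD2pi cosN sinN.
  rewrite ca sa ltr0_norm //. by apply/eqP; rewrite eq_complex /= !mul0r subr0 addr0 mulNr opprK ![n * _]mulrC !divfK// !eqxx.
Qed.

Definition phi (R : realType) (p q : R[i]) : R :=
  arg ((q - p) / (q - conjc p)) / (pi *+ 2).

Definition config (R : realType) n := n.-tuple (R * R).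

Definition zpoint (R : realType) n (z : config R n) (k : 'I_n) : R[i] :=
  Complex (tnth z k).1 (tnth z k).2.

Definition position (R : realType) n (z : config R n) (v : kvertex n) : R[i] :=
  match v with Aerial k => zpoint z k | Bar1 => 0 | Bar2 => 1 end.

Definition conf_space (R : realType) n : set (config R n) :=
  [set z | (forall k, 0 < complex.Im (zpoint z k)) /\ injective (zpoint z)].

Definition edge_angle (R : realType) n (G : kgraph n) (k : 'I_n) (i : 'I_2)
    (z : config R n) : R :=
  phi (zpoint z k) (position z (G k i)).

(* [z] with the real (c = 0) or imaginary (c = 1) part of z_j increased by h *)
Definition shift_coord (R : realType) n (z : config R n) (j : 'I_n) (c : 'I_2) (h : R)
    : config R n :=
  [tuple if k != j then tnth z k
         else if c == 0 then ((tnth z k).1 + h, (tnth z k).2)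
         else ((tnth z k).1, (tnth z k).2 + h) | k < n].

Definition mod1 (R : realType) (x : R) : R := x - (Num.floor x)%:~R.

(* The partial derivative of f with respect to Re z_j (c = 0) or Im z_j (c = 1),
   where f is only meaningful modulo 1: f is differentiated through its branch
   with values in [f z - 1/2, f z + 1/2[ (up to the additive constant
   f z - 1/2).  It is the ordinary partial derivative where f is continuous,
   and is insensitive to the jump of the representative of an angle at 0 = 1. *)
Definition partial_mod1 (R : realType) n (f : config R n -> R) (z : config R n)
    (j : 'I_n) (c : 'I_2) : R :=
  derive1 (fun h : R => mod1 (f (shift_coord z j c h) - f z + 2^-1)) 0.

(* The coefficient of /\_k (d phi_k^1 /\ d phi_k^2) on
   dx_1 /\ dy_1 /\ ... /\ dx_n /\ dy_n, where z_k = x_k + i y_k: the Jacobian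
   determinant of (phi_1^1, phi_1^2, ..., phi_n^1, phi_n^2) with respect to
   (x_1, y_1, ..., x_n, y_n), which are positively oriented coordinates. *)
Definition omega (R : realType) n (G : kgraph n) (z : config R n) : R :=
  \det (\mxblock_(k < n, j < n)
          \matrix_(i < 2, c < 2) partial_mod1 (edge_angle G k i) z j c).

(* n-fold product of the (sigma-finite) measure mu, on n-tuples *)
Fixpoint tuple_measure d (T : measurableType d) (R : realType)
    (mu : set T -> \bar R) n : set (n.-tuple T) -> \bar R :=
  match n with
  | 0 => \d_[tuple]
  | m.+1 => pushforward (mu \x tuple_measure mu (n := m))%E
              (fun p : T * m.-tuple T => [tuple of p.1 :: p.2])
  end.

Section cons_measure.
Local Open Scope ereal_scope.
Context d (T : measurableType d) (R : realType).
Variables (mu : {sigma_finite_measure set T -> \bar R}) (n : nat).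
Variable m : {sigma_finite_measure set (n.-tuple T) -> \bar R}.

Let f (p : T * n.-tuple T) : n.+1.-tuple T := [tuple of p.1 :: p.2].
Let mf : measurable_fun [set: T * n.-tuple T] f.
Proof. by apply: measurable_cons; [exact: measurable_fst|exact: measurable_snd]. Qed.

Definition cons_measure := pushforward (mu \x m) f.

Let cm0 : cons_measure set0 = 0.
Proof. by rewrite /cons_measure /pushforward preimage_set0 measure0. Qed.
Let cm_ge0 A : 0 <= cons_measure A.
Proof. by rewrite /cons_measure /pushforward measure_ge0. Qed.
Let cm_sigma : semi_sigma_additive cons_measure.
Proof.
move=> F mF tF mUF; rewrite /cons_measure /pushforward preimage_bigcup.
apply: measure_semi_sigma_additive.
- by move=> k; rewrite -[X in measurable X]setTI; exact: mf.
- apply/trivIsetP => /= i j _ _ ij; rewrite -preimage_setI.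
  by move/trivIsetP : tF => /(_ _ _ _ _ ij) ->//; rewrite preimage_set0.
- by rewrite -preimage_bigcup -[X in measurable X]setTI; exact: mf.
Qed.
HB.instance Definition _ := isMeasure.Build _ _ _ cons_measure cm0 cm_ge0 cm_sigma.

Let cm_sf : sigma_finite setT cons_measure.
Proof.
have [F TF HF] : sigma_finite setT (mu \x m).
  have /sigma_finiteP[F [TF ndF Foo]] := sigma_finiteT mu.
  have /sigma_finiteP[G [TG ndG Goo]] := sigma_finiteT m.
  exists (fun n => F n `*` G n).
    rewrite -setXTT TF TG predeqE => -[x y]; split.
      move=> [/= [i _ Fnx] [k _ Gky]]; exists (maxn i k) => //; split.
      - by move: x Fnx; exact/subsetPset/ndF/leq_maxl.
      - by move: y Gky; exact/subsetPset/ndG/leq_maxr.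
    by move=> [i _ []/= ? ?]; split; exists i.
  move=> k; have [? ?] := Foo k; have [? ?] := Goo k.
  split; first exact: measurableX.
  by rewrite product_measure1E// lte_mul_pinfty// ge0_fin_numE.
pose g (z : n.+1.-tuple T) : T * n.-tuple T := (thead z, [tuple of behead z]).
have mg : measurable_fun [set: n.+1.-tuple T] g.
  apply/measurable_fun_pairP; split.
    exact: measurable_tnth.
  exact: measurable_behead.
have fgK : cancel f g by move=> [x y]; rewrite /f /g /= theadE; congr pair; apply: val_inj.
exists (fun i => g @^-1` F i).
  by rewrite -preimage_bigcup -TF preimage_setT.
move=> i; have [mFi Fi] := HF i; split.
  by rewrite -[X in measurable X]setTI; exact: mg.
rewrite /cons_measure /pushforward -comp_preimage.
by rewrite (_ : g \o f = id) //; apply/funext => x /=; rewrite fgK.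
Qed.
HB.instance Definition _ := Measure_isSigmaFinite.Build _ _ _ cons_measure cm_sf.
End cons_measure.

Lemma tuple_measureP d (T : measurableType d) (R : realType)
    (mu : {sigma_finite_measure set T -> \bar R}) n :
  exists2 m : {sigma_finite_measure set (n.-tuple T) -> \bar R},
    tuple_measure mu (n := n) = m &
    forall A : 'I_n -> set T, (forall i, measurable (A i)) ->
      m [set z | forall i, A i (tnth z i)] = (\prod_(i < n) mu (A i))%E.
Proof.
elim: n => [|n [m em mA]].
  exists (\d_([tuple] : 0.-tuple T)) => //.
  by move=> A _; rewrite big_ord0 /= diracE mem_set//= => -[].
exists (cons_measure mu m); first by rewrite /= em.
move=> A mAi.
rewrite /cons_measure /pushforward big_ord_recl /= -mA //.
rewrite -product_measure1E //.
  apply: (congr1 (mu \x m)%E); apply/seteqP; split => [[x y] /= h|[x y] /= [h0 h] i].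
    split; first by have := h ord0; rewrite tnth0.
    by move=> i /=; have := h (lift ord0 i); rewrite tnthS.
  by case: (unliftP ord0 i) => [j|] ->; rewrite ?tnthS ?tnth0.
have -> : [set z : n.-tuple T | forall i, A (lift ord0 i) (tnth z i)] =
   \bigcap_(i in [set: 'I_n]) ((fun z => tnth z i) @^-1` A (lift ord0 i)).
  by apply/seteqP; split => [z h i _|z h i]; [exact: h|exact: (h i Logic.I)].
apply: fin_bigcap_measurable; first exact: finite_finset.
move=> i _; rewrite -[X in measurable X]setTI.
exact: measurable_tnth.
Qed.

Definition lebesgue_config (R : realType) n : set (config R n) -> \bar R :=
  tuple_measure (@lebesgue_measure R \x @lebesgue_measure R)%E (n := n).

(* The integral over the compactified configuration space is taken over its
   interior [conf_space]: the form is smooth on the compact manifold with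
   corners, whose boundary is negligible, so that this is a Lebesgue integral.
   It is extended-real valued, and is finite only if the positive and negative
   parts of [omega] both have a finite integral. *)
Definition weight (R : realType) n (G : kgraph n) : \bar R :=
  (\int[@lebesgue_config R n]_(z in @conf_space R n) (omega G z)%:E)%E.

Definition oint (R : realType) (a b : R) (f : R -> R) : R :=
  if a <= b then \int[lebesgue_measure]_(x in `[a, b]) f x
  else - \int[lebesgue_measure]_(x in `[b, a]) f x.

Fixpoint tree_int (R : realType) (t : rtree) (theta : R) : R :=
  match t with
  | RNode [::] => 2^-1 - theta
  | RNode ts =>
      oint 0 1 (fun lambda => oint theta lambda (fun theta' =>
        \prod_(J <- [seq tree_int s | s <- ts]) J theta'))
  end.

(* Main.v *)
(** The second edge of a vertex ends at its parent, so the Jacobian matrix of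
    the angles is block triangular for the depth grading and the form is the
    product over the vertices [k] of a kernel [J(z_k, p_k)], where [p_k] is the
    parent of [z_k], or [1] for the root.  In the coordinates
    [z = y (u + i)], with [u] the cotangent of [arg z], the kernel is for fixed
    [u] a sum of two functions of [y] with arctangent primitives, and for a
    function [g] of the angle [arg z / pi], Fubini gives
      [int J(z, p) g(z) dz = int_0^1 g(t) ([t > theta] - t) dt
                           = int_0^1 dlambda int_theta^lambda g(t) dt],
    with [theta = arg p / pi].  Hence integrating out a leaf multiplies the
    integrand by a polynomial in the angle of its parent, and the same bounds
    applied to absolute values give integrability.  Induction on the number of
    vertices concludes. *)

From HB Require Import structures.
Require Import Defs.
From mathcomp Require Import all_boot all_order all_algebra.
From mathcomp Require Import complex ring lra zify.
From mathcomp Require Import all_classical all_reals all_analysis.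
From mathcomp Require Import measurable_realfun.

Set Implicit Arguments.
Unset Strict Implicit.
Unset Printing Implicit Defensive.

Import Order.TTheory GRing.Theory Num.Theory.
Import numFieldNormedType.Exports.

Local Open Scope classical_set_scope.
Local Open Scope ring_scope.

(** * Determinants of graded block matrices *)

(** Removing a leaf leaves a factor attached to its parent, so an induction on the plain integrand
    does not close. The statement that does concerns graded forests in which each vertex [k] carries
    a polynomial weight [g k] in its angle; the empty forest is the base case. Polynomials suffice
    because [branch] preserves them. They are bounded on [0, 1], and the bound for one vertex is
    uniform in the position of its parent: this uniformity carries absolute integrability from the
    smaller forest to the larger one, which must be known before Fubini can be applied to the signed
    form. The root is attached to 1, a point of angle 0, whence the evaluation of the recursion at
    0. Integration runs over whole planes: [kernel] is extended by 0 off the upper half-plane and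
    collisions form a null set, so no domain has to be carried through the induction. The angles
    jump by 1; their derivatives are taken on an arctangent branch, and [arg] itself is never
    differentiated. *)

Lemma det_castmx (F : comPzRingType) m n (e e' : m = n) (A : 'M[F]_m) :
  \det (castmx (e, e') A) = \det A.
Proof. by rewrite (eq_irrelevance e' e); case: n / e e'. Qed.

(* Conjugation by [diag('X^d)] multiplies the entry [(i, j)] by
   ['X^(d i - d j)]; the determinant is unchanged and is evaluated at [0]. *)
Lemma det_graded (F : idomainType) N (A : 'M[F]_N) (d : 'I_N -> nat) :
  (forall i j, A i j != 0 -> (d j <= d i)%N) ->
  \det A = \det (\matrix_(i, j) if d i == d j then A i j else 0).
Proof.
move=> dA.
pose B : 'M[{poly F}]_N := \matrix_(i, j) (A i j *: 'X^(d i - d j)).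
pose D : 'M[{poly F}]_N := diag_mx (\row_j 'X^(d j)).
have BD : B *m D = D *m map_mx polyC A.
  apply/matrixP => i j; rewrite mul_mx_diag mul_diag_mx !mxE.
  have [->|/dA dji] := eqVneq (A i j) 0; first by rewrite scale0r mul0r mulr0.
  by rewrite -scalerAl -exprD subnK // mulrC mul_polyC.
have D0 : \det D != 0.
  rewrite det_diag; apply/prodf_neq0 => i _.
  by rewrite mxE expf_neq0// polyX_eq0.
have /(mulIf D0) detB : \det B * \det D = (\det A)%:P * \det D.
  by rewrite -det_mulmx BD det_mulmx det_map_mx mulrC.
have -> : \det A = (\det B).[0] by rewrite detB hornerC.
rewrite -[_.[0]]/(horner_eval 0 _) -det_map_mx; congr (\det _).
apply/matrixP => i j; rewrite !mxE -[LHS]/(horner (A i j *: _) 0) hornerZ hornerXn.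
have [->|/dA dji] := eqVneq (A i j) 0; first by rewrite mul0r; case: ifP.
rewrite expr0n subn_eq0; have [->|ne] := eqVneq (d i) (d j).
  by rewrite leqnn mulr1.
by rewrite leqNgt ltn_neqAle eq_sym ne dji mulr0.
Qed.

Lemma det_mxblock_diag (F : comPzRingType) n (p_ : 'I_n -> nat)
    (B : forall i j, 'M[F]_(p_ i, p_ j)) :
  (forall i j, i != j -> B i j = 0) ->
  \det (\mxblock_(i, j) B i j) = \prod_i \det (B i i).
Proof.
elim: n p_ B => [|n IH] p_ B B0.
  suff detE m (M : 'M[F]_m) : m = 0%N -> \det M = 1.
    by rewrite [RHS]big_ord0 detE// big_ord0.
  by move=> m0; subst m; rewrite det_mx00.
rewrite mxblock_recul det_castmx.
have -> : \mxrow_j B ord0 (lift ord0 j) = 0.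
  by rewrite -[RHS]mxrow0; apply: eq_mxrow => j; rewrite B0.
rewrite det_lblock IH ?big_ord_recl// => i j ij.
by rewrite B0// (inj_eq lift_inj).
Qed.

Lemma det_mxblock_graded (F : idomainType) n (p_ : 'I_n -> nat)
    (B : forall i j, 'M[F]_(p_ i, p_ j)) (d : 'I_n -> nat) :
  (forall i j, i != j -> (d i <= d j)%N -> B i j = 0) ->
  \det (\mxblock_(i, j) B i j) = \prod_i \det (B i i).
Proof.
move=> B0.
(* Lexicographic refinement of [d] by the index: it separates blocks of equal depth, so that only
   the diagonal blocks have equal grades. *)
pose e (i : 'I_n) := (d i * n + i)%N.
have e_inj : injective e.
  move=> i j eij; apply: val_inj; rewrite /e in eij.
  have := congr1 (modn^~ n) eij.
  by rewrite /= !modnMDl !modn_small.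
have ed i j : (e i < e j)%N -> (d i <= d j)%N.
  rewrite /e => eij; rewrite leqNgt; apply/negP => dji.
  have := ltn_ord j; nia.
rewrite (@det_graded _ _ _ (fun k => e (tagnat.sig1 k))); last first.
  move=> i j; rewrite mxE; apply: contraR; rewrite -ltnNge => eij.
  by rewrite B0 ?mxE ?ed //; apply: contraTneq eij => ->; rewrite ltnn.
pose C i j := if i == j then B i j else 0.
have -> : \matrix_(i, j) (if e (tagnat.sig1 i) == e (tagnat.sig1 j)
    then (\mxblock_(i, j) B i j) i j else 0) = \mxblock_(i, j) C i j.
  apply/matrixP => i j; rewrite !mxE (inj_eq e_inj) /C.
  by case: eqP => // _; rewrite mxE.
rewrite det_mxblock_diag; first by apply: eq_bigr => i _; rewrite /C eqxx.
by move=> i j /negPf ij; rewrite /C ij.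
Qed.

(** * Angles and the Jacobian of the form *)

Section Angles.
Variable R : realType.
Implicit Types (a r x y : R).

Lemma arg_polar r a : 0 < r -> 0 <= a < pi *+ 2 ->
  arg (Complex (r * cos a) (r * sin a)) = a.
Proof.
move=> r0 /andP[a0 a2]; rewrite /arg normc_def /=.
have -> : (r * cos a) ^+ 2 + (r * sin a) ^+ 2 = r ^+ 2.
  by rewrite !exprMn -mulrDr cos2Dsin2 mulr1.
rewrite sqrtr_sqr gtr0_norm // mulrAC divff ?lt0r_neq0// mul1r pmulr_rge0//.
have [api|pia] := leP a pi.
  by rewrite sin_ge0_pi ?a0// cosK// in_itv/= a0.
have s0 : sin a < 0.
  have := @sin_gt0_pi R (a - pi); rewrite subr_gt0 pia ltrBlDr -mulr2n a2.
  by rewrite sinB cospi sinpi mulr0 subr0 mulrN1 oppr_gt0; apply.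
rewrite leNgt s0 /= -[cos a]cosN -(cosD2pi (- a)) cosK ?in_itv/=.
  by rewrite opprD opprK addrCA subrr addr0.
by rewrite addrC subr_ge0 (ltW a2) mulr2n -addrA gerDl subr_le0 ltW.
Qed.

Lemma arg_scale r (w : R[i]) : 0 < r -> arg (Complex r 0 * w) = arg w.
Proof.
move=> r0; case: w => x y; rewrite /arg !normc_def /= !mul0r subr0 addr0.
rewrite pmulr_rge0// !exprMn -mulrDr sqrtrM ?sqr_ge0// sqrtr_sqr gtr0_norm//.
by rewrite invfM mulrACA divff ?mul1r// lt0r_neq0.
Qed.

Lemma mod1_id x (k : int) : 0 <= x < 1 -> mod1 (x + k%:~R) = x.
Proof.
move=> /andP[x0 x1]; rewrite /mod1 (@floor_def _ _ k) ?addrK//.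
by rewrite lerDr x0 addrC intrD ltrD2l.
Qed.

(* Two directions at less than a right angle: the branch of the argument near
   [w0] is [arg w0 + atan (N / D)], up to a full turn. *)
Lemma mod1_arg (w w0 : R[i]) :
  let D := complex.Re w * complex.Re w0 + complex.Im w * complex.Im w0 in
  let N := complex.Im w * complex.Re w0 - complex.Re w * complex.Im w0 in
  0 < D ->
  mod1 (arg w / (pi *+ 2) - arg w0 / (pi *+ 2) + 2^-1) =
  atan (N / D) / (pi *+ 2) + 2^-1.
Proof.
move=> D N D0.
have pi0 : 0 < pi :> R := pi_gt0 R.
have p20 : 0 < (pi *+ 2 : R) by rewrite pmulrn_lgt0.
pose d : R := atan (N / D).
have w00 : w0 != 0.
  by apply: contraTneq D0 => w00; rewrite /D w00 /= !mulr0 addr0 ltxx.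
have [/andP[a0 a2] w0E] := argP w00; move: a0 a2 w0E.
set a := arg w0 => a0 a2 w0E.
have d1 : - (pi / 2) < d := atan_gtNpi2 _.
have d2 : d < pi / 2 := atan_ltpi2 _.
have cd0 : 0 < cos d by rewrite cos_gt0_pihalf// d1.
have sd : sin d = N / D * cos d.
  by rewrite -[N / D]atanK -/d /tan divfK ?lt0r_neq0.
pose r0 := complex.Re `|w0|.
have r00 : 0 < r0.
  rewrite /r0 normc_def /= sqrtr_gt0; case: (w0) w00 => x y.
  by rewrite eq_complex /= negb_and lt0r paddr_eq0 ?sqr_ge0// !sqrf_eq0 negb_and addr_ge0 ?sqr_ge0// andbT.
have [e1 e2] : complex.Re w0 = r0 * cos a /\ complex.Im w0 = r0 * sin a.
  move: w0E; rewrite /r0 normc_def /=; set s := Num.sqrt _ => ->.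
  by rewrite /= !mul0r subr0 addr0.
have wE : w = Complex (D / cos d / r0 * cos (a + d)) (D / cos d / r0 * sin (a + d)).
  have DN1 : D * cos a - N * sin a = r0 * complex.Re w.
    rewrite /D /N e1 e2 -[RHS]mulr1 -(cos2Dsin2 a); ring.
  have DN2 : D * sin a + N * cos a = r0 * complex.Im w.
    rewrite /D /N e1 e2 -[RHS]mulr1 -(cos2Dsin2 a); ring.
  have r0n := lt0r_neq0 r00; have cdn := lt0r_neq0 cd0; have Dn := lt0r_neq0 D0.
  rewrite cosD sinD sd; apply/eqP; rewrite eq_complex /=; apply/andP; split; apply/eqP.
    have -> : complex.Re w = (D * cos a - N * sin a) / r0 by rewrite DN1 mulrC mulKf.
    by field; rewrite Dn r0n cdn.
  have -> : complex.Im w = (D * sin a + N * cos a) / r0 by rewrite DN2 mulrC mulKf.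
  by field; rewrite Dn r0n cdn.
have R0 : 0 < D / cos d / r0 by rewrite !divr_gt0.
(* Since [a + d] lies between [- pi / 2] and [5 pi / 2], the number of turns [k] is 1, 0 or -1. *)
have [k kE] : exists k : int, arg w = a + d + pi *+ 2 * k%:~R.
  move: wE R0; set rho := _ / _ / _ => -> R0; have [ad|ad] := ltP (a + d) 0.
    exists 1; rewrite -cosD2pi -sinD2pi arg_polar ?mulr1//.
    by apply/andP; split; lra.
  have [ad2|ad2] := ltP (a + d) (pi *+ 2).
    by exists 0; rewrite arg_polar ?mulr0 ?addr0// ad ad2.
  exists (-1).
  rewrite -[a + d](subrK (pi *+ 2)) cosD2pi sinD2pi arg_polar//.
    by rewrite mulrN1 subrK.
  by apply/andP; split; lra.
have -> : arg w / (pi *+ 2) - a / (pi *+ 2) + 2^-1 = (d / (pi *+ 2) + 2^-1) + k%:~R.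
  rewrite kE -/d; set t := pi *+ 2; field; exact: lt0r_neq0.
(* The added one half centres the branch: [d] is less than a quarter turn in absolute value, so the
   value stays between 1/4 and 3/4, away from the jump of [mod1]. *)
rewrite mod1_id// -(ler_pM2r p20) -(ltr_pM2r p20) mulrDl divfK ?lt0r_neq0//.
by apply/andP; split; lra.
Qed.

End Angles.

Section Angles.
Variable R : realType.
Implicit Types (a r x y : R).

(** Multiplication by the positive real [r], the squared modulus of [q - conjc p], clears the
    denominator and keeps the argument. What remains is the complex number [(p - a)^2 + b^2], a
    polynomial in the moving point [p]. *)
Lemma phiE x y a b : 0 < y -> 0 <= b ->
  phi (Complex x y) (Complex a b) =
  arg (Complex ((x - a) ^+ 2 + b ^+ 2 - y ^+ 2) (y * (x - a) *+ 2)) / (pi *+ 2).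
Proof.
move=> y0 b0; rewrite /phi; congr (_ / _).
pose r := (a - x) ^+ 2 + (b + y) ^+ 2.
have r0 : 0 < r by rewrite ltr_wpDl ?sqr_ge0// exprn_gt0// ltr_wpDl.
rewrite -(@arg_scale _ r)//; congr arg.
rewrite /r; apply/eqP; rewrite eq_complex /=; apply/andP; split; apply/eqP;
  by field; rewrite !opprK lt0r_neq0//.
Qed.

(** When [p] moves along a line, numerator and denominator of the quotient in [mod1_arg] are
    quadratic in the step [h]. The numerator vanishes at [h = 0], so only its linear coefficient
    survives. *)
Lemma is_derive_atan_quot (n1 n2 D0 d1 d2 c k : R) : D0 != 0 ->
  is_derive (0 : R) 1 (fun h : R => atan ((n1 * h + n2 * h ^+ 2) /
    (D0 + d1 * h + d2 * h ^+ 2)) * c + k) (n1 / D0 * c).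
Proof.
move=> D00.
have dN : is_derive (0 : R) 1 (fun h : R => n1 * h + n2 * h ^+ 2) n1.
  apply: is_derive_eq.
  by rewrite /GRing.scale /=; ring.
have dD : is_derive (0 : R) 1 (fun h : R => D0 + d1 * h + d2 * h ^+ 2) d1.
  apply: is_derive_eq.
  by rewrite /GRing.scale /=; ring.
have D0' : D0 + d1 * 0 + d2 * 0 ^+ 2 != 0 by rewrite !mulr0 expr0n mulr0 !addr0.
have dQ := is_deriveM dN (@is_deriveV _ (fun h : R => D0 + d1 * h + d2 * h ^+ 2) _ _ _ D0' dD).
have dA := is_derive1_comp (is_derive1_atan _) dQ.
have dc (t : R) : is_derive t 1 (fun t : R => t * c + k) c.
  apply: is_derive_eq.
  by rewrite /GRing.scale /=; ring.
apply: (@is_derive_eq _ _ _ _ _ _ _ _ (is_derive1_comp (dc _) dA)).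
rewrite /GRing.scale /=.
rewrite -[X in 1 + X ^+ 2]/((n1 * 0 + n2 * 0 ^+ 2) * (D0 + d1 * 0 + d2 * 0 ^+ 2)^-1).
rewrite !mulr0 expr0n !mulr0 !addr0 mul0r expr0n/= addr0 invr1.
by ring.
Qed.

Lemma derive1_phi x y a b c1 c2 : 0 < y -> 0 <= b -> (x, y) != (a, b) ->
  let X := (x - a) ^+ 2 + b ^+ 2 - y ^+ 2 in
  let Y := y * (x - a) *+ 2 in
  let dX := ((x - a) * c1 - y * c2) *+ 2 in
  let dY := (y * c1 + (x - a) * c2) *+ 2 in
  derive1 (fun h => mod1 (phi (Complex (x + c1 * h) (y + c2 * h)) (Complex a b) -
      phi (Complex x y) (Complex a b) + 2^-1)) 0 =
  (dY * X - Y * dX) / (X ^+ 2 + Y ^+ 2) / (pi *+ 2).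
Proof.
move=> y0 b0 pq X Y dX dY.
pose D0 := X ^+ 2 + Y ^+ 2.
have D00 : 0 < D0.
  (* The squared modulus of [(p - a)^2 + b^2] is the product of the squared distances from [p] to
     [q] and to its conjugate; only the first could vanish, and the points are distinct. *)
  have -> : D0 = ((x - a) ^+ 2 + (y - b) ^+ 2) * ((x - a) ^+ 2 + (y + b) ^+ 2).
    by rewrite /D0 /X /Y; ring.
  rewrite mulr_gt0//; last by rewrite ltr_wpDl ?sqr_ge0// exprn_gt0// ltr_wpDr.
  rewrite lt0r addr_ge0 ?sqr_ge0// andbT paddr_eq0 ?sqr_ge0// !sqrf_eq0 !subr_eq0.
  by move: pq; rewrite xpair_eqE.
(* With [c = c1 + i c2], the increment of [(p - a)^2 + b^2] is [2 (p - a) c h + c^2 h^2]: its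
   coefficients have parts [dX], [dY] and [X2], [Y2]. [D] and [N] are then the [D] and [N] of
   [mod1_arg]. *)
pose X2 := c1 ^+ 2 - c2 ^+ 2; pose Y2 := c1 * c2 *+ 2.
pose D h := D0 + (dX * X + dY * Y) * h + (X2 * X + Y2 * Y) * h ^+ 2.
pose N h := (dY * X - dX * Y) * h + (Y2 * X - X2 * Y) * h ^+ 2.
rewrite derive1E.
have dA := is_derive_atan_quot (dY * X - dX * Y) (Y2 * X - X2 * Y)
  (dX * X + dY * Y) (X2 * X + Y2 * Y) (pi *+ 2)^-1 2^-1 (lt0r_neq0 D00).
have -> : (dY * X - Y * dX) / (X ^+ 2 + Y ^+ 2) / (pi *+ 2) =
   (dY * X - dX * Y) / D0 / (pi *+ 2) by rewrite [Y * dX]mulrC.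
rewrite -(@derive_val _ _ _ _ _ _ _ dA); apply: near_eq_derive.
have cD : {for 0, continuous D}.
  apply: differentiable_continuous; apply/derivable1_diffP.
  exact: ex_derive.
have cy : {for 0, continuous (fun h => y + c2 * h)}.
  apply: differentiable_continuous; apply/derivable1_diffP.
  exact: ex_derive.
have D_near : \forall h \near 0, 0 < D h.
  apply: (cvgr_gt _ cD).
  by rewrite /D mulr0 expr0n mulr0 !addr0.
have y_near : \forall h \near 0, 0 < y + c2 * h.
  apply: (cvgr_gt _ cy).
  by rewrite mulr0 addr0.
near=> h.
have Dh : 0 < D h by near: h.
have yh : 0 < y + c2 * h by near: h.
rewrite !phiE//.
set w := Complex _ _; set w0 := Complex X Y.
have DE : complex.Re w * complex.Re w0 + complex.Im w * complex.Im w0 = D h.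
  by rewrite /= /D /D0 /X2 /Y2 /dX /dY /X /Y; ring.
have NE : complex.Im w * complex.Re w0 - complex.Re w * complex.Im w0 = N h.
  by rewrite /= /N /X2 /Y2 /dX /dY /X /Y; ring.
have := @mod1_arg R w w0; rewrite /= in DE NE *.
by rewrite DE NE => ->.
Unshelve. all: by end_near. Qed.

End Angles.

Lemma det2 (F : comPzRingType) (A : 'M[F]_2) :
  \det A = A 0 0 * A 1 1 - A 0 1 * A 1 0.
Proof.
rewrite (expand_det_row _ ord0) !big_ord_recl big_ord0 addr0.
rewrite /cofactor !det_mx11 !mxE /=.
by rewrite !addn0 addn1 expr0 expr1 mul1r mulN1r mulrN; congr (_ * A _ _ - A _ _ * A _ _);
  apply: val_inj.
Qed.

(* The Jacobian at [z] of [(arg z / pi, phi z p)]. *)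
Definition kernel (R : realType) (z p : R * R) : R :=
  if 0 < z.2 then
    (2 * pi ^+ 2 * (z.1 ^+ 2 + z.2 ^+ 2))^-1 *
    ((z.2 * p.1 - z.1 * p.2) / ((z.1 - p.1) ^+ 2 + (z.2 - p.2) ^+ 2) +
     (z.2 * p.1 + z.1 * p.2) / ((z.1 - p.1) ^+ 2 + (z.2 + p.2) ^+ 2))
  else 0.

Definition parent_point (R : realType) n (par : 'I_n -> option 'I_n)
    (z : config R n) (k : 'I_n) : R * R :=
  if par k is Some j then tnth z j else (1, 0).

Section Jacobian.
Variables (R : realType) (n : nat).
Implicit Types (z : config R n) (k j : 'I_n).

Lemma zpoint_shift z k c h : zpoint (shift_coord z k c h) k =
  Complex ((tnth z k).1 + (c == 0)%:R * h) ((tnth z k).2 + (c != 0)%:R * h).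
Proof.
by rewrite /zpoint tnth_mktuple eqxx /=; case: eqP => _ /=;
  rewrite mul1r mul0r addr0.
Qed.

Lemma zpoint_shift_neq z k j c h : k != j ->
  zpoint (shift_coord z j c h) k = zpoint z k.
Proof. by move=> kj; rewrite /zpoint tnth_mktuple kj. Qed.

Lemma partial_mod1_edge (G : kgraph n) k i z c (q : R * R) :
  0 < (tnth z k).2 -> 0 <= q.2 -> tnth z k != q ->
  (forall h, position (shift_coord z k c h) (G k i) = Complex q.1 q.2) ->
  position z (G k i) = Complex q.1 q.2 ->
  let x := (tnth z k).1 in let y := (tnth z k).2 in
  let a := q.1 in let b := q.2 in
  let c1 := (c == 0)%:R in let c2 := (c != 0)%:R in
  let X := (x - a) ^+ 2 + b ^+ 2 - y ^+ 2 in
  let Y := y * (x - a) *+ 2 in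
  let dX := ((x - a) * c1 - y * c2) *+ 2 in
  let dY := (y * c1 + (x - a) * c2) *+ 2 in
  partial_mod1 (edge_angle G k i) z k c =
  (dY * X - Y * dX) / (X ^+ 2 + Y ^+ 2) / (pi *+ 2).
Proof.
move=> y0 b0 pq qh q0 x y a b c1 c2 X Y dX dY; rewrite /partial_mod1.
rewrite -derive1_phi//.
congr (derive1 _ 0); apply/funext => h.
by rewrite /edge_angle zpoint_shift qh q0.
Qed.

Lemma partial_mod1_const (f : config R n -> R) z j c :
  (forall h, f (shift_coord z j c h) = f z) -> partial_mod1 f z j c = 0.
Proof.
move=> fE; rewrite /partial_mod1.
under eq_fun do rewrite fE subrr add0r.
exact: derive1_cst.
Qed.

(** In a diagonal block only [z_k] moves and both targets stay fixed, so [derive1_phi] gives its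
    four entries; the grading keeps a vertex distinct from its parent, and [conf_space] separates
    their points. *)
Lemma omega_ktree (par : 'I_n -> option 'I_n) (d : 'I_n -> nat) z :
  (forall k j, par k = Some j -> (d j < d k)%N) ->
  conf_space z ->
  omega (ktree par) z = \prod_k kernel (tnth z k) (parent_point par z k).
Proof.
move=> dP [zpos zinj]; rewrite /omega (@det_mxblock_graded _ _ _ _ d); last first.
  move=> i j ij dij; apply/matrixP => e c; rewrite !mxE.
  apply: partial_mod1_const => h; rewrite /edge_angle zpoint_shift_neq//.
  congr (phi _ _); rewrite /ktree; case: eqP => //= _.
  case pi: (par i) => [l|]//=; rewrite zpoint_shift_neq//.
  by apply: contraTneq dij => <-; rewrite -ltnNge dP.
apply: eq_bigr => k _; rewrite det2 !mxE.
have y0 : 0 < (tnth z k).2 := zpos k.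
pose q := parent_point par z k.
have q0 : 0 <= q.2.
  rewrite /q /parent_point; case: (par k) => [j|]//=.
  exact/ltW/zpos.
have kq : tnth z k != q.
  rewrite /q /parent_point; case pk: (par k) => [j|].
    have : k != j by apply/eqP => kj; have := dP _ _ pk; rewrite kj ltnn.
    apply: contraNneq => e; apply/eqP/zinj.
    by rewrite /zpoint e.
  by apply/eqP => e; move: y0; rewrite e ltxx.
have posq : position z (ktree par k 1) = Complex q.1 q.2.
  by rewrite /ktree /q /parent_point /=; case: (par k).
have poshq c h : position (shift_coord z k c h) (ktree par k 1) = Complex q.1 q.2.
  rewrite /ktree /q /parent_point /=; case pk: (par k) => [j|]//=.
  rewrite zpoint_shift_neq//.
  by apply/eqP => kj; have := dP _ _ pk; rewrite kj ltnn.
have k0 : tnth z k != (0, 0) by apply/eqP => e; move: y0; rewrite e ltxx.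
rewrite !(@partial_mod1_edge _ _ 1 _ _ q)//.
rewrite !(@partial_mod1_edge _ _ 0 _ _ (0, 0))//.
rewrite /kernel y0 -/q /=.
move: q q0 kq {posq poshq k0}  => [a b] /=.
case: (tnth z k) y0 => x y /= y0 b0 kq.
have A0 : (x - a) ^+ 2 + (y - b) ^+ 2 != 0.
  rewrite paddr_eq0 ?sqr_ge0// !sqrf_eq0 !subr_eq0.
  by move: kq; rewrite xpair_eqE.
have B0 : (x - a) ^+ 2 + (y + b) ^+ 2 != 0.
  by rewrite lt0r_neq0// ltr_wpDl ?sqr_ge0// exprn_gt0// ltr_wpDr.
have C0 : x ^+ 2 + y ^+ 2 != 0.
  by rewrite lt0r_neq0// ltr_wpDl ?sqr_ge0// exprn_gt0.
(* The denominators from [derive1_phi] factor: into two squared distances for the parent, and into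
   the fourth power of the modulus of [z] for the target 0. *)
have AB : ((x - a) ^+ 2 + b ^+ 2 - y ^+ 2) ^+ 2 + (y * (x - a) *+ 2) ^+ 2 =
   ((x - a) ^+ 2 + (y - b) ^+ 2) * ((x - a) ^+ 2 + (y + b) ^+ 2) by ring.
have CC : ((x - 0) ^+ 2 + 0 ^+ 2 - y ^+ 2) ^+ 2 + (y * (x - 0) *+ 2) ^+ 2 =
   (x ^+ 2 + y ^+ 2) ^+ 2 by ring.
have pi0 : pi != 0 :> R by rewrite lt0r_neq0// pi_gt0.
rewrite AB CC; move: (@pi R) pi0 => p p0; field.
by rewrite A0 B0 C0.
Qed.
End Jacobian.

(** * Polynomials and the recursion *)

Section Poly.
Variable R : realType.
Implicit Types (p g : {poly R}) (a b x : R).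

(* The constant coefficient is [p`_0 / 0 = 0]. *)
Definition primp p : {poly R} := \poly_(i < (size p).+1) (p`_i.-1 / i%:R).

Lemma deriv_primp p : deriv (primp p) = p.
Proof.
apply/polyP => i; rewrite coef_deriv coef_poly ltnS /=.
have [ip|pi] := ltnP i (size p).
  by rewrite -[LHS]mulr_natr divfK// pnatr_eq0.
by rewrite mul0rn nth_default.
Qed.

Lemma horner_primp0 p : (primp p).[0] = 0.
Proof. by rewrite horner_coef0 coef_poly /= invr0 mulr0. Qed.

(** Uniqueness of the antiderivative vanishing at 0; explicit primitives are recognised through it,
    from their derivative alone. *)
Lemma primpE p g : deriv g = p -> primp p = g - (g.[0])%:P.
Proof.
move=> <-; apply/polyP => i; rewrite coefB coefC coef_poly ltnS.
case: i => [|i]; rewrite /= ?subr0; first by rewrite invr0 mulr0 horner_coef0 subrr.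
have [ip|pi] := ltnP i (size (deriv g)).
  by rewrite coef_deriv -[X in X / _]mulr_natr mulfK// pnatr_eq0.
(* Beyond the size of the derivative, [i.+1] times the coefficient of index [i.+1] of [g] is 0,
   hence so is that coefficient. *)
have := congr1 (fun r : {poly R} => r`_i) (erefl (deriv g)).
rewrite {1}nth_default// coef_deriv => /esym/eqP; rewrite mulrn_eq0 /=.
by move/eqP.
Qed.

(** The recursion operator on polynomials: with [G = primp g], the integral of [G(l) - G(a)] over
    [l] in [0, 1] is [(primp G)(1) - G(a)], a polynomial in [a]. *)
Definition branch g : {poly R} := ((primp (primp g)).[1])%:P - primp g.

Lemma derive1_horner p x : derive1 (horner p) x = (deriv p).[x].
Proof. by rewrite derive1E derive_val. Qed.

Lemma Rintegral_horner p a b : a <= b ->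
  \int[lebesgue_measure]_(x in `[a, b]) p.[x] = (primp p).[b] - (primp p).[a].
Proof.
rewrite le_eqVlt => /predU1P[<-|ab].
  by rewrite set_itv1 Rintegral_set1 subrr.
rewrite /Rintegral (@continuous_FTC2 _ _ (horner (primp p)))//.
- apply: continuous_subspaceT; exact: continuous_horner.
- split.
  + by move=> x _; exact: derivable_horner.
  + apply: cvg_at_right_filter; exact: continuous_horner.
  + apply: cvg_at_left_filter; exact: continuous_horner.
- by move=> x _; rewrite derive1_horner deriv_primp.
Qed.

Lemma oint_horner p a b : oint a b (horner p) = (primp p).[b] - (primp p).[a].
Proof.
rewrite /oint; case: leP => [ab|/ltW ba]; rewrite Rintegral_horner//.
by rewrite opprB.
Qed.

Lemma oint_branch g a :
  oint 0 1 (fun l => oint a l (horner g)) = (branch g).[a].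
Proof.
have -> : (fun l => oint a l (horner g)) = horner (primp g - ((primp g).[a])%:P).
  by apply/funext => l; rewrite oint_horner hornerD hornerN hornerC.
rewrite oint_horner horner_primp0 subr0 /branch.
have -> : primp (primp g - (primp g).[a]%:P) = primp (primp g) - (primp g).[a] *: 'X.
  rewrite (@primpE _ (primp (primp g) - (primp g).[a] *: 'X)).
    by rewrite !(hornerD, hornerN, hornerC, hornerZ, hornerX) horner_primp0 mulr0 !subr0.
  by rewrite derivB deriv_primp derivZ derivX alg_polyC.
by rewrite !(hornerD, hornerN, hornerC, hornerZ, hornerX) mulr1.
Qed.

(** The one-vertex tree obeys the general recursion with an empty product, so [branch] covers both
    cases of [tree_int]. *)
Lemma branch1 : branch 1 = (2^-1)%:P - 'X.
Proof.
have p1 : primp 1 = 'X by rewrite (@primpE _ 'X) ?derivX// hornerX subr0.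
have pX : primp 'X = 2^-1 *: 'X^2.
  rewrite (@primpE _ (2^-1 *: 'X^2)).
    by rewrite hornerZ hornerXn expr0n mulr0 subr0.
  by rewrite derivZ derivXn expr1 -scalerMnr scalerMnl -[2^-1 *+ _]mulr_natr mulVf ?scale1r// pnatr_eq0.
by rewrite /branch p1 pX hornerZ hornerXn expr1n mulr1.
Qed.

(** [Q] is indexed by vertices and its products run over the fibres of [par], which is the form
    produced by integrating out vertices. Induction on [has_shape] matches it with the term [t],
    whatever the enumeration of the children. *)
Lemma tree_int_horner n (par : 'I_n -> option 'I_n) (Q : 'I_n -> {poly R}) v t :
  (forall k, Q k = branch (\prod_(c | par c == Some k) Q c)) ->
  has_shape par v t -> tree_int t = horner (Q v).
Proof.
move=> QE; elim => {}v cs ts pcs scs _ IH; apply/funext => x.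
have prodE y : (\prod_(c | par c == Some v) Q c).[y] =
    \prod_(J <- [seq tree_int s | s <- ts]) J y.
  have -> : \prod_(c | par c == Some v) Q c = \prod_(c <- cs) Q c.
    by rewrite (perm_big _ pcs)/= big_filter big_enum_cond.
  rewrite horner_prod big_map.
  rewrite (big_nth v) (big_nth (RNode [::])) scs !big_mkord.
  by apply: eq_bigr => i _; rewrite IH.
case: ts scs IH prodE => [|t0 ts] scs IH prodE.
  rewrite QE big1_seq.
    by rewrite branch1 hornerD hornerN hornerC hornerX.
  move=> c /andP[pc _]; move/perm_size: pcs; rewrite scs.
  move/esym/size0nil/eqP; rewrite -[_ == _]negbK -has_filter => /hasPn/(_ c).
  by rewrite mem_enum pc; move/(_ isT).
rewrite QE -oint_branch.
rewrite (_ : horner _ = fun y => \prod_(J <- [seq tree_int s | s <- t0 :: ts]) J y)//.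
by apply/funext => y; rewrite prodE.
Qed.
End Poly.

(** * Arctangent integrals *)

Section Atan.
Variable R : realType.
Implicit Types (u v c e m x y : R).

(** Here [s = atan u + atan v] lies strictly between 0 and pi, so [s - pi / 2] is in the range of
    [atan], and its tangent is minus the cotangent of [s]. *)
Lemma atanD_gt0 u v : 0 < u + v ->
  pi / 2 + atan ((u * v - 1) / (u + v)) = atan u + atan v.
Proof.
move=> uv0; pose s := atan u + atan v.
have u1 := atan_gtNpi2 u; have u2 := atan_ltpi2 u.
have v1 := atan_gtNpi2 v; have v2 := atan_ltpi2 v.
have s0 : 0 < s.
  have : - v < u by lra.
  by move/(@lt_atan R); rewrite atanN /s; lra.
have cu : cos (atan u) != 0 by rewrite lt0r_neq0// cos_gt0_pihalf// u1.
have cv : cos (atan v) != 0 by rewrite lt0r_neq0// cos_gt0_pihalf// v1.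
have su : sin (atan u) = u * cos (atan u) by rewrite -{2}[u]atanK /tan divfK.
have sv : sin (atan v) = v * cos (atan v) by rewrite -{2}[v]atanK /tan divfK.
have -> : (u * v - 1) / (u + v) = tan (s - pi / 2).
  rewrite /tan sinBpihalf cosBpihalf /s cosD sinD su sv.
  have uvn := lt0r_neq0 uv0.
  field; rewrite uvn andbT.
  rewrite (_ : _ + _ = (u + v) * (cos (atan u) * cos (atan v))); last by ring.
  by rewrite !mulf_neq0.
rewrite tanK; first by rewrite addrC subrK.
move: s0; rewrite in_itv /= /s => s0; apply/andP; split; lra.
Qed.

(* [int_0^oo c m / ((m y - e)^2 + c^2) dy] *)
Definition angle_jump c e : R := Num.sg c * (pi / 2 + atan (e / `|c|)).

Lemma angle_jump_le c e : `|angle_jump c e| <= pi.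
Proof.
have p0 : 0 < pi :> R := pi_gt0 R.
have t1 := atan_gtNpi2 (e / `|c|); have t2 := atan_ltpi2 (e / `|c|).
rewrite /angle_jump normrM; apply: (@le_trans _ _ (1 * pi)); last by rewrite mul1r.
apply: ler_pM => //; first by rewrite normr_sg; case: eqP.
by rewrite ler_norml; apply/andP; split; lra.
Qed.

Lemma angle_jumpD u v : angle_jump (u + v) (u * v - 1) = atan u + atan v.
Proof.
rewrite /angle_jump; have [uv|uv|uv] := ltrgt0P (u + v).
- by rewrite gtr0_sg// mul1r atanD_gt0.
- rewrite ltr0_sg// mulN1r.
  have := @atanD_gt0 (- u) (- v); rewrite -opprD oppr_gt0 !atanN mulrNN => /(_ uv).
  lra.
- have -> : v = - u by lra.
  by rewrite subrr sgr0 mul0r atanN subrr.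
Qed.

(** Changing the signs of both [c] and [e] changes [angle_jump] by [Num.sg c * pi], which reduces
    the claim to [angle_jumpD u (- v)]. This sign is the origin of the step function in the integral
    over the angle. *)
Lemma angle_jumpB u v :
  angle_jump (v - u) (u * v + 1) = Num.sg (v - u) * pi + atan u - atan v.
Proof.
have := angle_jumpD u (- v); rewrite atanN mulrN -opprD /angle_jump.
rewrite -[u - v]opprB sgrN normrN !mulNr atanN; have [uv|uv|uv] := ltrgt0P (v - u).
- rewrite (gtr0_sg uv); lra.
- rewrite (ltr0_sg uv); lra.
- have -> : v = u by lra.
  rewrite !subrr sgr0 !mul0r; lra.
Qed.

Lemma angle_jumpZ b c e : 0 < b -> angle_jump (b * c) (b * e) = angle_jump c e.
Proof.
move=> b0; rewrite /angle_jump sgrM gtr0_sg// mul1r normrM (gtr0_norm b0).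
by rewrite -mulf_div divff ?mul1r// lt0r_neq0.
Qed.

(** For [p = b (v + i)] the two contributions of [atan v] cancel: [p] enters only through the side
    of [v] on which [u] lies. *)
Lemma angle_jump_parent u (p : R * R) : 0 < p.2 \/ p = (1, 0) ->
  angle_jump (p.1 - u * p.2) (p.1 * u + p.2) +
  angle_jump (p.1 + u * p.2) (p.1 * u - p.2) =
  Num.sg (p.1 - u * p.2) * pi + atan u *+ 2.
Proof.
case: p => a b [/= b0|[-> ->]]; last first.
  rewrite /= !mulr0 !mul1r !subr0 !addr0 /angle_jump sgr1 normr1 !divr1 !mul1r; lra.
have bn := lt0r_neq0 b0; pose v := a / b.
have -> : a - u * b = b * (v - u) by rewrite /v; field.
have -> : a * u + b = b * (u * v + 1) by rewrite /v; field.
have -> : a + u * b = b * (u + v) by rewrite /v; field.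
have -> : a * u - b = b * (u * v - 1) by rewrite /v; field.
by rewrite !angle_jumpZ// angle_jumpB angle_jumpD sgrM (gtr0_sg b0) mul1r; lra.
Qed.

Local Notation mu := (@lebesgue_measure R).

Lemma integral_angle_gt0 c m e : 0 < c -> 0 < m ->
  (\int[mu]_(y in `[0%R, +oo[) (c * m / ((m * y - e) ^+ 2 + c ^+ 2))%:E =
   (pi / 2 + atan (e / c))%:E)%E.
Proof.
move=> c0 m0.
have cn := lt0r_neq0 c0.
have d0 y : 0 < (m * y - e) ^+ 2 + c ^+ 2 by rewrite ltr_wpDl ?sqr_ge0// exprn_gt0.
pose F y := atan ((m * y - e) / c).
have dF y : is_derive y 1 F (c * m / ((m * y - e) ^+ 2 + c ^+ 2)).
  have dl : is_derive y 1 (fun y => (m * y - e) / c) (m / c).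
    by apply: is_derive_eq; rewrite /GRing.scale /=; ring.
  apply: (@is_derive_eq _ _ _ _ _ _ _ _ (is_derive1_comp (is_derive1_atan _) dl)).
  field; rewrite cn /=.
  by rewrite !lt0r_neq0// ?d0// addrC.
have cF : continuous F.
  move=> y; apply/differentiable_continuous/derivable1_diffP.
  by case: (dF y).
have cden : continuous (fun y => (m * y - e) ^+ 2 + c ^+ 2).
  by move=> y; apply/differentiable_continuous/derivable1_diffP; exact: ex_derive.
rewrite (@ge0_continuous_FTC2y _ _ F _ (pi / 2)).
- by rewrite /F mulr0 sub0r mulNr atanN EFinN oppeK.
- by move=> y _; rewrite divr_ge0// ?(ltW (d0 y))// mulr_ge0 ?ltW.
- apply: continuous_subspaceT => y.
  apply: cvgM; first exact: cvg_cst.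
  apply: cvgV; first exact: lt0r_neq0.
  exact: cden.
- apply: (cvg_comp _ _ _ (@cvgy_atan R)).
  apply/cvgryPge => A; near=> y.
  rewrite ler_pdivlMr// lerBrDr -ler_pdivrMl//.
- by move=> y _; case: (dF y).
- exact/cvg_at_right_filter/cF.
- by move=> y _; rewrite derive1E derive_val.
Unshelve. all: by end_near. Qed.

(** The integrand keeps the sign of [c], so taking absolute values amounts to replacing [c] by its
    absolute value. *)
Lemma integral_angle_abs c m e : 0 < m ->
  (\int[mu]_(y in `[0%R, +oo[) (`|c * m / ((m * y - e) ^+ 2 + c ^+ 2)|)%:E =
   `|angle_jump c e|%:E)%E.
Proof.
move=> m0; have [->|c0] := eqVneq c 0.
  rewrite integral0_eq ?/angle_jump ?sgr0 ?mul0r ?normr0//.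
  by move=> y _; rewrite !mul0r normr0.
have c0' : 0 < `|c| by rewrite normr_gt0.
under eq_integral => y _.
  rewrite normrM normrV ?unitfE; last first.
    by rewrite lt0r_neq0// ltr_wpDl ?sqr_ge0// exprn_even_gt0.
  rewrite [`|c * m|]normrM (gtr0_norm m0) [`|_ + _|]ger0_norm ?addr_ge0 ?sqr_ge0//.
  rewrite -[c ^+ 2]real_normK ?num_real//.
  over.
rewrite integral_angle_gt0//; congr EFin.
rewrite /angle_jump normrM normr_sg c0 mul1r [RHS]ger0_norm//.
have := @atan_gtNpi2 R (e / `|c|); lra.
Qed.

Lemma integral_angle c m e : 0 < m ->
  (\int[mu]_(y in `[0%R, +oo[) (c * m / ((m * y - e) ^+ 2 + c ^+ 2))%:E =
   (angle_jump c e)%:E)%E.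
Proof.
move=> m0; have [c0|c0|->] := ltrgt0P c; last 2 first.
- have c0' : 0 < - c by rewrite oppr_gt0.
  under eq_integral => y _.
    rewrite (_ : c * m / _ = - (- c * m / ((m * y - e) ^+ 2 + (- c) ^+ 2))).
      by rewrite EFinN; over.
    by rewrite sqrrN !mulNr opprK.
  rewrite integral_ge0N; last first.
    by move=> y _; rewrite lee_fin divr_ge0 ?addr_ge0 ?sqr_ge0// mulr_ge0// ltW.
  by rewrite integral_angle_gt0// /angle_jump ltr0_sg// ltr0_norm// mulN1r.
- rewrite integral0_eq ?/angle_jump ?sgr0 ?mul0r//.
  by move=> y _; rewrite !mul0r.
by rewrite integral_angle_gt0// /angle_jump gtr0_sg// gtr0_norm// mul1r.
Qed.

End Atan.

(** * Polynomials in the angle, integrated against the Cauchy density *)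

Section Cauchy.
Variable R : realType.
Implicit Types (u v x y : R) (p q g : {poly R}).

(* The normalized angle [arg (u + i) / pi]. *)
Definition angle_of_cot u : R := 2^-1 - atan u / pi.

(** Minus the derivative of [angle_of_cot]: against this density, an integral over the cotangent
    becomes one over the normalized angle. *)
Definition cauchy_density u : R := (pi * (1 + u ^+ 2))^-1.

Local Notation tau := angle_of_cot.
Local Notation w := cauchy_density.
Local Notation mu := (@lebesgue_measure R).

Lemma angle_of_cot01 u : 0 <= tau u <= 1.
Proof.
have p0 : 0 < pi :> R := pi_gt0 R.
have u1 := atan_gtNpi2 u; have u2 := atan_ltpi2 u.
have h1 : - 2^-1 <= atan u / pi by rewrite ler_pdivlMr//; lra.
have h2 : atan u / pi <= 2^-1 by rewrite ler_pdivrMr//; lra.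
by rewrite /tau; apply/andP; split; lra.
Qed.

Lemma angle_of_cotN u : tau (- u) = 1 - tau u.
Proof. by rewrite /tau atanN; lra. Qed.

Lemma oneDsqr_gt0 u : 0 < 1 + u ^+ 2.
Proof. by rewrite ltr_pwDl// sqr_ge0. Qed.

Lemma cauchy_density_ge0 u : 0 <= w u.
Proof. by rewrite invr_ge0 mulr_ge0 ?pi_ge0// ltW// oneDsqr_gt0. Qed.

Lemma cauchy_densityN u : w (- u) = w u.
Proof. by rewrite /w sqrrN. Qed.

Lemma is_derive_angle_of_cot u : is_derive u 1 tau (- w u).
Proof.
rewrite /tau; apply: is_derive_eq.
by rewrite /GRing.scale /= !mulr0 !add0r mul1r /w invfM.
Qed.

Lemma continuous_angle_of_cot : continuous tau.
Proof.
move=> u; apply/differentiable_continuous/derivable1_diffP.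
by case: (is_derive_angle_of_cot u).
Qed.

Lemma continuous_cauchy_density : continuous w.
Proof.
move=> u; apply: cvgV; first by rewrite mulf_neq0 ?lt0r_neq0 ?pi_gt0 ?oneDsqr_gt0.
have : {for u, continuous (fun u => pi * (1 + u ^+ 2))}.
  by apply/differentiable_continuous/derivable1_diffP; exact: ex_derive.
exact.
Qed.

Lemma cvgy_angle_of_cot : tau u @[u --> +oo] --> (0 : R).
Proof.
have -> : (0 : R) = 2^-1 - (pi / 2) / pi.
  by rewrite mulrAC divff ?mul1r ?subrr// lt0r_neq0// pi_gt0.
apply: cvgB; first exact: cvg_cst.
apply: cvgMl; exact: cvgy_atan.
Qed.

Lemma continuous_horner_angle q : continuous (fun u => q.[tau u] * w u).
Proof.
move=> u; apply: cvgM; last exact: continuous_cauchy_density.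
apply: (@cvg_comp _ _ _ tau (horner q)); first exact: continuous_angle_of_cot.
exact: continuous_horner.
Qed.

(** As [u] goes from [v] to infinity, the angle decreases from [tau v] to 0, where [primp q]
    vanishes. *)
Lemma integral_angle_right q v : (forall x, 0 <= x <= 1 -> 0 <= q.[x]) ->
  (\int[mu]_(u in `[v, +oo[) (q.[tau u] * w u)%:E = ((primp q).[tau v])%:E)%E.
Proof.
move=> q0; pose F u := - (primp q).[tau u].
have dF u : is_derive u 1 F (q.[tau u] * w u).
  have := is_deriveN (is_derive1_comp (is_derive_poly (primp q) _) (is_derive_angle_of_cot u)).
  by rewrite deriv_primp mulrN opprK.
rewrite (@ge0_continuous_FTC2y _ _ F _ 0).
- by rewrite sub0e -EFinN /F opprK.
- by move=> u _; rewrite mulr_ge0 ?cauchy_density_ge0// q0// angle_of_cot01.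
- exact/continuous_subspaceT/continuous_horner_angle.
- rewrite -oppr0 -(horner_primp0 q); apply: cvgN.
  apply: (cvg_comp _ _ cvgy_angle_of_cot); exact: continuous_horner.
- by move=> u _; case: (dF u).
- apply: cvg_at_right_filter.
  apply/differentiable_continuous/derivable1_diffP.
  by case: (dF v).
- by move=> u _; rewrite derive1E; apply: derive_val.
Qed.

(** The reflection of [u] exchanges the angles [t] and [1 - t], which reduces the claim to
    [integral_angle_right] for [q \Po (1 - 'X)]. *)
Lemma integral_angle_left q v : (forall x, 0 <= x <= 1 -> 0 <= q.[x]) ->
  (\int[mu]_(u in `]-oo, v]) (q.[tau u] * w u)%:E =
   ((primp q).[1] - (primp q).[tau v])%:E)%E.
Proof.
move=> q0; rewrite -[v]opprK ge0_integration_by_substitutionNy; last 2 first.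
- exact/continuous_subspaceT/continuous_horner_angle.
- by move=> u _; rewrite mulr_ge0 ?cauchy_density_ge0// q0// angle_of_cot01.
pose q' := q \Po (1 - 'X).
have q'E : primp q' = ((primp q).[1])%:P - (primp q \Po (1 - 'X)).
  rewrite (@primpE _ _ (- (primp q \Po (1 - 'X)))).
    by rewrite hornerN horner_comp hornerD hornerC hornerN hornerX subr0 polyCN opprK addrC.
  by rewrite derivN deriv_comp deriv_primp derivB derivX -polyC1 derivC sub0r mulrN mulr1 opprK.
have -> : ((primp q).[1] - (primp q).[tau (- - v)]) = (primp q').[tau (- v)].
  by rewrite q'E hornerD hornerN hornerC horner_comp hornerD hornerC hornerN hornerX -angle_of_cotN.
rewrite -integral_angle_right; last first.
  move=> x x01; rewrite /q' horner_comp q0// hornerD hornerC hornerN hornerX.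
  by move/andP: x01 => [? ?]; apply/andP; split; lra.
apply: eq_integral => u _; congr EFin.
by rewrite /= cauchy_densityN angle_of_cotN /q' horner_comp hornerD hornerC hornerN hornerX.
Qed.

Lemma horner_bounded q : exists2 C : R, 0 <= C & forall x, 0 <= x <= 1 -> `|q.[x]| <= C.
Proof.
exists (\sum_(i < size q) `|q`_i|); first exact: sumr_ge0.
move=> x /andP[x0 x1]; rewrite horner_coef (le_trans (ler_norm_sum _ _ _))//.
apply: ler_sum => i _; rewrite normrM ler_piMr// ger0_norm ?exprn_ge0//.
exact: exprn_ile1.
Qed.

Lemma primpD_const q C : primp (q + C%:P) = primp q + C *: 'X.
Proof.
rewrite (@primpE _ _ (primp q + C *: 'X)).
  by rewrite hornerD horner_primp0 hornerZ hornerX mulr0 addr0 subr0.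
by rewrite derivD deriv_primp derivZ derivX alg_polyC.
Qed.

Lemma primpC (C : R) : primp C%:P = C *: 'X.
Proof.
have := primpD_const 0 C; rewrite add0r => ->.
by rewrite (@primpE _ _ 0) ?deriv0// horner0 subr0 add0r.
Qed.

(* A large constant added to [q] reduces to a nonnegative integrand. *)
Lemma integral_angle_shift (D : set (measurableTypeR R)) q (I : {poly R} -> R) : measurable D ->
  {morph I : p1 p2 / p1 + p2} ->
  (forall p, (forall x, 0 <= x <= 1 -> 0 <= p.[x]) ->
    (\int[mu]_(u in D) (p.[tau u] * w u)%:E = (I p)%:E)%E) ->
  mu.-integrable D (fun u => (q.[tau u] * w u)%:E) /\
  (\int[mu]_(u in D) (q.[tau u] * w u)%:E = (I q)%:E)%E.
Proof.
move=> mD ID int_ge0.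
have [C C0 qC] := horner_bounded q.
pose h p u := p.[tau u] * w u.
have h0 p : (forall x, 0 <= x <= 1 -> 0 <= p.[x]) -> forall u, 0 <= h p u.
  by move=> p0 u; rewrite mulr_ge0 ?cauchy_density_ge0// p0// angle_of_cot01.
have mh p : measurable_fun D (fun u => (h p u)%:E).
  apply/measurable_EFinP; apply: measurable_funTS; apply: continuous_measurable_fun.
  exact: continuous_horner_angle.
have ih p : (forall x, 0 <= x <= 1 -> 0 <= p.[x]) -> mu.-integrable D (fun u => (h p u)%:E).
  move=> p0; apply/integrableP; split; first exact: mh.
  under eq_integral do rewrite /= ger0_norm ?h0//.
  by rewrite int_ge0// ltry.
have q1 x : 0 <= x <= 1 -> 0 <= (q + C%:P).[x].
  move=> x01; have := qC x x01; rewrite hornerD hornerC ler_norml => /andP[? _]; lra.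
have q2 x : 0 <= x <= 1 -> 0 <= C%:P.[x] by rewrite hornerC.
have qE : (fun u => (q.[tau u] * w u)%:E) =
    (fun u => (h (q + C%:P) u)%:E - (h C%:P u)%:E)%E.
  by apply/funext => u; rewrite -EFinB /h hornerD mulrDl addrK.
split; rewrite qE; first exact: (integrableB mD (ih _ q1) (ih _ q2)).
rewrite (integralB_EFin mD (ih _ q1) (ih _ q2)).
by rewrite !int_ge0// -EFinB ID addrK.
Qed.

(** Nothing is asked of [f] at [v], a null set: there the sign function of the application takes its
    third value 0. *)
Lemma integral_angle_split (f : measurableTypeR R -> R) q1 q2 v : measurable_fun setT f ->
  (forall u, u < v -> f u = q1.[tau u] * w u) ->
  (forall u, v < u -> f u = q2.[tau u] * w u) ->
  (\int[mu]_u (f u)%:E =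
   ((primp q1).[1] - (primp q1).[tau v] + (primp q2).[tau v])%:E)%E.
Proof.
move=> mf f1 f2.
have mfE (D : set (measurableTypeR R)) : measurable_fun D (EFin \o f).
  by apply/measurable_EFinP/measurable_funTS.
have pD : {morph @primp R : p1 p2 / p1 + p2}.
  move=> p1 p2; rewrite (@primpE _ _ (primp p1 + primp p2)).
    by rewrite hornerD !horner_primp0 addr0 subr0.
  by rewrite derivD !deriv_primp.
have mq q (D : set (measurableTypeR R)) : measurable_fun D (fun u => (q.[tau u] * w u)%:E).
  apply/measurable_EFinP; apply: measurable_funTS; apply: continuous_measurable_fun.
  exact: continuous_horner_angle.
rewrite -(itv_setU_setT false v) integral_setU//=; last first.
  apply/disj_setPS => x [] /=; rewrite !in_itv /= andbT => xv vx.
  by move: (le_lt_trans xv vx); rewrite ltxx.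
rewrite EFinD; congr (_ + _)%E.
  rewrite -[LHS]integral_itv_bndo_bndc; last exact: mfE.
  rewrite (eq_integral (fun u : measurableTypeR R => (q1.[tau u] * w u)%:E)); last first.
    by move=> u; rewrite inE/= in_itv/= => uv; rewrite f1.
  rewrite integral_itv_bndo_bndc; last exact: mq.
  apply: (proj2 (@integral_angle_shift _ _ (fun q => (primp q).[1] - (primp q).[tau v]) _ _ _)) => //.
    by move=> p1 p2; rewrite pD !hornerD; lra.
  by move=> p p0; exact: integral_angle_left.
rewrite (eq_integral (fun u : measurableTypeR R => (q2.[tau u] * w u)%:E)); last first.
  by move=> u; rewrite inE/= in_itv/= andbT => uv; rewrite f2.
rewrite [LHS]integral_itv_obnd_cbnd; last exact: mq.
apply: (proj2 (@integral_angle_shift _ _ (fun q => (primp q).[tau v]) _ _ _)) => //.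
  by move=> p1 p2; rewrite pD !hornerD.
by move=> p p0; exact: integral_angle_right.
Qed.

(* With [GG'' = g], both integrands have explicit primitives:
   [(1 - X) g = ((1 - X) GG' + GG)'] and [- X g = (- X GG' + GG)']. *)
Lemma integral_angle_branch (f : measurableTypeR R -> R) g v (a : R) : measurable_fun setT f ->
  (forall u, u < v -> f u = (1 - tau u) * g.[tau u] * w u) ->
  (forall u, v < u -> f u = (a - tau u) * g.[tau u] * w u) ->
  a = 0 \/ a = 1 ->
  (\int[mu]_u (f u)%:E = ((branch g).[if a == 0 then tau v else 0])%:E)%E.
Proof.
move=> mf f1 f2 a01.
pose G c := (c%:P - 'X) * primp g + primp (primp g).
have GE c : primp ((c%:P - 'X) * g) = G c.
  rewrite (@primpE _ _ (G c)).
    by rewrite /G hornerD hornerM !horner_primp0 mulr0 addr0 subr0.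
  by rewrite /G derivD derivM !deriv_primp derivB derivC derivX sub0r mulN1r addrC addrA subrr add0r.
rewrite (@integral_angle_split _ ((1%:P - 'X) * g) ((a%:P - 'X) * g) v)//.
- congr EFin; rewrite !GE /G /branch; have [->|->] := a01.
    by rewrite eqxx !(hornerD, hornerN, hornerM, hornerC, hornerX); lra.
  rewrite oner_eq0 !(hornerD, hornerN, hornerM, hornerC, hornerX) !horner_primp0; lra.
- by move=> u uv; rewrite f1// hornerM hornerD hornerC hornerN hornerX.
- by move=> u uv; rewrite f2// hornerM hornerD hornerC hornerN hornerX.
Qed.

End Cauchy.

(** * Polar coordinates *)

Section Polar.
Variable R : realType.
Implicit Types (u v x y : R).
Local Notation mu := (@lebesgue_measure R).
Local Notation RR := (measurableTypeR R).

(** The right-hand side is a measure with the value of Lebesgue measure on intervals []a, b]], so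
    uniqueness of the latter applies. *)
Lemma lebesgue_measure_scale y (A : set RR) : 0 < y -> measurable A ->
  mu A = (y%:E * pushforward mu ( *%R y : RR -> RR) A)%E.
Proof.
move=> y0 mA.
pose f : RR -> RR := *%R y.
have mf : measurable_fun [set: RR] f by exact: mulrl_measurable.
have H := @lebesgue_measure_unique R (mscale (NngNum (ltW y0)) (pushforward mu f)).
have {H} := H mf _ A mA; apply.
move=> _ [[a b]] _ <-.
have fE : f @^-1` `]a, b] = `]a / y, b / y]%classic.
  apply/seteqP; split => u /=; rewrite !in_itv /=;
    by rewrite ltr_pdivrMr// ler_pdivlMr// ![u * y]mulrC.
rewrite -[RHS]/(y%:E * mu (f @^-1` `]a, b]%classic))%E fE.
rewrite !lebesgue_measure_itv/= !lte_fin ltr_pM2r ?invr_gt0//.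
case: ifPn => _; last by rewrite mule0.
by rewrite -!EFinD -EFinM; congr EFin; field; rewrite lt0r_neq0.
Qed.

Lemma ge0_integral_scale y (F : RR -> \bar R) : 0 < y ->
  measurable_fun setT F -> (forall x, 0 <= F x)%E ->
  (\int[mu]_x F x = \int[mu]_u (F (y * u)%R * y%:E))%E.
Proof.
move=> y0 mF F0.
pose f : RR -> RR := *%R y.
have mf : measurable_fun [set: RR] f by exact: mulrl_measurable.
rewrite ge0_integralZr//=; [|exact: measurableT_comp|by rewrite lee_fin ltW].
rewrite muleC.
pose m : {measure set RR -> \bar R} :=
  measure_function_pushforward__canonical__measure_function_Measure mu mf.
transitivity (\int[mscale (NngNum (ltW y0)) m]_x F x)%E.
  by apply: eq_measure_integral => A mA _; exact: lebesgue_measure_scale.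
by rewrite ge0_integral_mscale//= ge0_integral_pushforward.
Qed.

Lemma integral_scale y (F : RR -> \bar R) : 0 < y ->
  measurable_fun setT F ->
  (\int[mu]_x F x = \int[mu]_u (F (y * u)%R * y%:E))%E.
Proof.
move=> y0 mF; rewrite integralE [RHS]integralE.
congr (_ - _)%E.
  rewrite (ge0_integral_scale y0)//; last exact: measurable_funepos.
  by apply: eq_integral => u _; rewrite !funeposE maxe_pMl ?mul0e// lee_fin ltW.
rewrite (ge0_integral_scale y0)//; last exact: measurable_funeneg.
by apply: eq_integral => u _; rewrite !funenegE -mulNe maxe_pMl ?mul0e// lee_fin ltW.
Qed.

(* Polar coordinates in the chart [(x, y) = (y u, y)] of the upper half plane,
   where [u] is the cotangent of the polar angle. *)
Definition cot_chart (f : R * R -> R) (q : R * R) : R :=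
  if 0 < q.2 then f (q.2 * q.1, q.2) * q.2 else 0.

Lemma measurable_cot_chart (f : RR * RR -> R) : measurable_fun setT f ->
  measurable_fun setT (cot_chart f : RR * RR -> R).
Proof.
move=> mf; rewrite /cot_chart; apply: measurable_fun_ifT => //.
- apply: measurable_fun_ltr => //; exact: measurable_snd.
- apply: measurable_funM; last exact: measurable_snd.
  apply: (measurableT_comp mf); apply/measurable_fun_pairP; split => /=.
    by apply: measurable_funM; [exact: measurable_snd|exact: measurable_fst].
  exact: measurable_snd.
Qed.

(** On a horizontal line the chart is the scaling [x = y u]. The planar change of variables thus
    reduces to one-dimensional scaling and an exchange of integrals. *)
Lemma integral_cot_chart_row (f : RR * RR -> R) y : measurable_fun setT f ->
  (forall x y, y <= 0 -> f (x, y) = 0) ->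
  (\int[mu]_x (f (x, y))%:E = \int[mu]_u (cot_chart f (u, y))%:E)%E.
Proof.
move=> mf f0; have [y0|y0] := ltP 0 y; last first.
  rewrite !integral0_eq// => u _; first by rewrite /cot_chart /= ltNge y0.
  by rewrite f0.
rewrite (integral_scale y0); last first.
  by apply/measurable_EFinP; exact: (measurable_fun_pair1 y mf).
by apply: eq_integral => u _; rewrite /cot_chart /= y0 EFinM.
Qed.

Lemma cot_chart_abs f q : cot_chart (fun z => `|f z|) q = `|cot_chart f q|.
Proof.
rewrite /cot_chart; case: ifPn => q0; last by rewrite normr0.
by rewrite normrM (gtr0_norm q0).
Qed.

Lemma integral_abs_cot_chart (f : RR * RR -> R) : measurable_fun setT f ->
  (forall x y, y <= 0 -> f (x, y) = 0) ->
  (\int[mu \x mu]_z `|(f z)%:E| = \int[mu]_u \int[mu]_y `|(cot_chart f (u, y))%:E|)%E.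
Proof.
move=> mf f0.
have mc := measurable_cot_chart mf.
have ma : measurable_fun setT (fun z => `|f z|) by exact: measurableT_comp.
rewrite fubini_tonelli2//; last first.
  by apply: measurableT_comp => //; exact/measurable_EFinP.
rewrite (fubini_tonelli (fun q : RR * RR => `|(cot_chart f q)%:E|%E))//; last first.
  by apply: measurableT_comp => //; exact/measurable_EFinP.
apply: eq_integral => y _.
rewrite /fubini_G.
under eq_integral do rewrite abse_EFin.
rewrite (@integral_cot_chart_row (fun z => `|f z|))//; last first.
  by move=> x' y' y0; rewrite f0// normr0.
by under eq_integral do rewrite cot_chart_abs -abse_EFin.
Qed.

Lemma integral_cot_chart (f : RR * RR -> R) : measurable_fun setT f ->
  (forall x y, y <= 0 -> f (x, y) = 0) ->
  (\int[mu \x mu]_z `|(f z)%:E| < +oo)%E ->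
  (\int[mu \x mu]_z (f z)%:E = \int[mu]_u \int[mu]_y (cot_chart f (u, y))%:E)%E.
Proof.
move=> mf f0 foo.
have mc := measurable_cot_chart mf.
have fi : (mu \x mu)%E.-integrable setT (EFin \o f).
  by apply/integrableP; split => //; exact/measurable_EFinP.
have ci : (mu \x mu)%E.-integrable setT (EFin \o (cot_chart f : RR * RR -> R)).
  apply/integrable12ltyP; first exact/measurable_EFinP.
  by rewrite -integral_abs_cot_chart.
rewrite (Fubini ci) -(integral21_prod_meas1 fi).
by apply: eq_integral => y _; exact: integral_cot_chart_row.
Qed.

End Polar.

(** * Integrating out one vertex *)

Section KernelIntegral.
Variable R : realType.
Implicit Types (u v x y : R) (g : {poly R}).
Local Notation mu := (@lebesgue_measure R).
Local Notation RR := (measurableTypeR R).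
Local Notation tau := (@angle_of_cot R).
Local Notation w := (@cauchy_density R).

Lemma measurable_inv : measurable_fun [set: RR] (@GRing.inv R : RR -> RR).
Proof.
have -> : [set: RR] = [set 0] `|` [set~ (0 : R)] by rewrite setUv.
apply/measurable_funU => //; first exact: measurableC.
split; first exact: measurable_fun_set1.
apply: open_continuous_measurable_fun.
  by apply: closed_openC; exact: closed_eq.
move=> x; rewrite inE /= => /eqP x0; exact: inv_continuous.
Qed.

Lemma measurable_funV d (T : measurableType d) (f : T -> R) :
  measurable_fun setT f -> measurable_fun setT (fun t => (f t)^-1).
Proof. by move=> mf; apply: (measurableT_comp measurable_inv). Qed.

Lemma measurable_kernel d (T : measurableType d) (z p : T -> R * R) :
  measurable_fun setT (fun t => (z t).1) -> measurable_fun setT (fun t => (z t).2) ->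
  measurable_fun setT (fun t => (p t).1) -> measurable_fun setT (fun t => (p t).2) ->
  measurable_fun setT (fun t => kernel (z t) (p t)).
Proof.
move=> x y a b; rewrite /kernel; apply: measurable_fun_ifT => //.
  exact: measurable_fun_ltr.
have m2 (f : T -> R) : measurable_fun [set: T] f -> measurable_fun [set: T] (fun t => f t ^+ 2).
  by move=> mf; apply: measurable_funX.
apply: measurable_funM.
  apply: measurable_funV; apply: measurable_funM => //.
  by apply: measurable_funD; exact: m2.
by apply: measurable_funD; apply: measurable_funM;
  try (apply: measurable_funV; apply: measurable_funD; apply: m2);
  (try apply: measurable_funB); (try apply: measurable_funD) => //; apply: measurable_funM.
Qed.

(** On the real axis the quotient is 0 by convention and the angle is read as 1/2, a meaningless
    value; hence the separate case in [branch_at]. *)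
Definition weight_of g (z : R * R) : R := g.[tau (z.1 / z.2)].

Lemma measurable_weight_of d (T : measurableType d) g (z : T -> R * R) :
  measurable_fun setT (fun t => (z t).1) -> measurable_fun setT (fun t => (z t).2) ->
  measurable_fun setT (fun t => weight_of g (z t)).
Proof.
move=> x y.
have mc (f : RR -> RR) h : continuous f -> measurable_fun [set: T] (h : T -> RR) ->
  measurable_fun [set: T] (f \o h).
  by move=> /continuous_measurable_fun cf mh; exact: measurableT_comp.
apply: (mc (horner g)); first exact: continuous_horner.
apply: (mc tau); first exact: continuous_angle_of_cot.
by apply: measurable_funM => //; exact: measurable_funV.
Qed.

(** Multiplying each denominator by [1 + u ^+ 2] completes the square in [y], which gives the
    integrands of [integral_angle] with [m = 1 + u ^+ 2]. *)
Lemma cot_chart_kernel g p u y : 0 < y ->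
  cot_chart (fun z => kernel z p * weight_of g z) (u, y) =
  g.[tau u] * w u / (pi *+ 2) *
  ((p.1 - u * p.2) * (1 + u ^+ 2) /
     (((1 + u ^+ 2) * y - (p.1 * u + p.2)) ^+ 2 + (p.1 - u * p.2) ^+ 2) +
   (p.1 + u * p.2) * (1 + u ^+ 2) /
     (((1 + u ^+ 2) * y - (p.1 * u - p.2)) ^+ 2 + (p.1 + u * p.2) ^+ 2)).
Proof.
move=> y0; rewrite /cot_chart /kernel /weight_of /= y0.
have m0 := oneDsqr_gt0 u; have mn := lt0r_neq0 m0; have yn := lt0r_neq0 y0.
have pn : pi != 0 :> R by rewrite lt0r_neq0// pi_gt0.
have -> : y * u / y = u by field.
have e c A A' : A' = (1 + u ^+ 2) * A -> c * (1 + u ^+ 2) / A' = c / A.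
  by move=> ->; rewrite invfM mulrA mulfK.
rewrite (e _ ((y * u - p.1) ^+ 2 + (y - p.2) ^+ 2)); last by ring.
rewrite (e _ ((y * u - p.1) ^+ 2 + (y + p.2) ^+ 2)); last by ring.
have -> : y * p.1 - y * u * p.2 = y * (p.1 - u * p.2) by ring.
have -> : y * p.1 + y * u * p.2 = y * (p.1 + u * p.2) by ring.
rewrite -!mulrA -!mulrDr /cauchy_density.
move: (g.[_]) (_ / _ + _ / _) (@pi R) pn => h t pi' pn.
have -> : (y * u) ^+ 2 + y ^+ 2 = y ^+ 2 * (1 + u ^+ 2) by ring.
by field; rewrite yn mn pn.
Qed.

(* The value at the normalized angle of [p], which is [0] for the terrestrial
   vertex [(1, 0)]. *)
Definition branch_at g (p : R * R) : R :=
  if p.2 == 0 then (branch g).[0] else weight_of (branch g) p.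

Lemma integral_halfline (F G : RR -> R) : measurable_fun setT G ->
  (forall y, 0 < y -> F y = G y) -> (forall y, y <= 0 -> F y = 0) ->
  (\int[mu]_y (F y)%:E = \int[mu]_(y in `[0%R, +oo[) (G y)%:E)%E.
Proof.
move=> mG FG F0; rewrite -integral_itv_obnd_cbnd; last first.
  by apply/measurable_EFinP; exact: measurable_funTS.
rewrite [RHS]integral_mkcond; apply: eq_integral => y _.
rewrite patchE; case: ifPn; first by rewrite inE/= in_itv/= andbT => /FG ->.
by rewrite notin_setE/= in_itv/= andbT => /negP; rewrite -leNgt => /F0 ->.
Qed.

Section fixed_parent.
Variables (g : {poly R}) (p : R * R).
Hypothesis p_upper : 0 < p.2 \/ p = (1, 0).

Let f (z : RR * RR) : R := kernel z p * weight_of g z.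

Let mf : measurable_fun setT f.
Proof.
apply: measurable_funM.
  by apply: measurable_kernel => //; [exact: measurable_fst|exact: measurable_snd].
by apply: measurable_weight_of; [exact: measurable_fst|exact: measurable_snd].
Qed.

Let f0 x y : y <= 0 -> f (x, y) = 0.
Proof. by move=> y0; rewrite /f /kernel /= ltNge y0 mul0r. Qed.

(** The summands of [cot_chart_kernel]: [c1], [e1] belong to [p], and [c2], [e2] to its
    conjugate. *)
Let T c e u y := c * (1 + u ^+ 2) / (((1 + u ^+ 2) * y - e) ^+ 2 + c ^+ 2).
Let c1 u := p.1 - u * p.2.
Let c2 u := p.1 + u * p.2.
Let e1 u := p.1 * u + p.2.
Let e2 u := p.1 * u - p.2.
Let k u := g.[tau u] * w u / (pi *+ 2).

Let mT c e u : measurable_fun setT (T c e u : RR -> R).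
Proof.
apply: measurable_funM => //; apply: measurable_funV; apply: measurable_funD => //.
by apply: measurable_funX; apply: measurable_funB => //; apply: measurable_funM.
Qed.

Let cE u y : 0 < y ->
  cot_chart f (u, y) = k u * (T (c1 u) (e1 u) u y + T (c2 u) (e2 u) u y).
Proof. by move=> y0; rewrite cot_chart_kernel. Qed.

Let c0 u y : y <= 0 -> cot_chart f (u, y) = 0.
Proof. by rewrite /cot_chart /= leNgt => /negPf ->. Qed.

Let intT_abs c e u :
  (\int[mu]_(y in `[0%R, +oo[) `|T c e u y|%:E = `|angle_jump c e|%:E)%E.
Proof. by rewrite integral_angle_abs// oneDsqr_gt0. Qed.

Let iT c e u : mu.-integrable `[0, +oo[ (EFin \o (T c e u : RR -> R)).
Proof.
apply/integrableP; split; first by apply/measurable_EFinP; exact: measurable_funTS.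
by under eq_integral do rewrite /= ; rewrite intT_abs ltry.
Qed.

Let int_row u : (\int[mu]_y (cot_chart f (u, y))%:E =
  (k u * (angle_jump (c1 u) (e1 u) + angle_jump (c2 u) (e2 u)))%:E)%E.
Proof.
rewrite (@integral_halfline _ (fun y => k u * (T (c1 u) (e1 u) u y + T (c2 u) (e2 u) u y))).
- under eq_integral do rewrite EFinM.
  rewrite integralZl//; last exact: (integrableD _ (iT _ _ _) (iT _ _ _)).
  rewrite [RHS]EFinM; congr (_ * _)%E.
  under eq_integral do rewrite EFinD.
  rewrite integralD//; [|exact: iT|exact: iT].
  by rewrite !integral_angle ?oneDsqr_gt0.
- by apply: measurable_funM => //; apply: measurable_funD; exact: mT.
- by move=> y; exact: cE.
- by move=> y; exact: c0.
Qed.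

(** Two jumps, each at most pi in absolute value, compensate the factor [(pi *+ 2)^-1] of [k]; the
    bound no longer involves [p]. *)
Let int_row_abs u : (\int[mu]_y `|(cot_chart f (u, y))%:E| <=
  (`|g.[tau u]| * w u)%:E)%E.
Proof.
have p0 : 0 < pi :> R := pi_gt0 R.
pose A (c e : R) : RR -> R := fun y => `|T c e u y|.
have mA c e (D : set RR) : measurable_fun D (A c e).
  by apply: measurable_funTS; apply: measurableT_comp => //; exact: mT.
have mAE c e (D : set RR) : measurable_fun D (EFin \o A c e).
  exact/measurable_EFinP.
have A0 c e y : 0 <= A c e y by rewrite /A.
under eq_integral do rewrite abse_EFin.
rewrite (@integral_halfline _ (fun y => `|k u * (T (c1 u) (e1 u) u y + T (c2 u) (e2 u) u y)|)); last 3 first.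
- apply: measurableT_comp => //.
  by apply: measurable_funM => //; apply: measurable_funD; exact: mT.
- by move=> y y0; rewrite cE.
- by move=> y y0; rewrite c0// normr0.
apply: (@le_trans _ _ (\int[mu]_(y in `[0%R, +oo[)
  (`|k u| * (A (c1 u) (e1 u) y + A (c2 u) (e2 u) y))%:E)%E).
  apply: ge0_le_integral => //.
  - apply/measurable_EFinP; apply: measurable_funTS; apply: measurableT_comp => //.
    by apply: measurable_funM => //; apply: measurable_funD; exact: mT.
  - by apply/measurable_EFinP; apply: measurable_funM => //; apply: measurable_funD; exact: mA.
  - move=> y _; rewrite lee_fin normrM ler_wpM2l//.
    exact: ler_normD.
under eq_integral do rewrite EFinM.
rewrite ge0_integralZl//; last 2 first.
- by apply/measurable_EFinP; apply: measurable_funD; exact: mA.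
- by move=> y _; rewrite lee_fin addr_ge0.
under eq_integral do rewrite EFinD.
rewrite ge0_integralD//; last 4 first.
- by move=> y _; rewrite lee_fin.
- exact: mAE.
- by move=> y _; rewrite lee_fin.
- exact: mAE.
rewrite !intT_abs -EFinD -EFinM lee_fin.
have p20 : 0 < pi *+ 2 :> R by rewrite pmulrn_lgt0.
have -> : `|k u| = `|g.[tau u]| * w u / (pi *+ 2).
  by rewrite /k normrM normfV (gtr0_norm p20) normrM (ger0_norm (cauchy_density_ge0 u)).
rewrite mulrAC ler_pdivrMr// ler_wpM2l ?mulr_ge0 ?cauchy_density_ge0// mulr2n.
by apply: lerD; exact: angle_jump_le.
Qed.

Lemma integral_abs_kernel (C : R) : (forall x, 0 <= x <= 1 -> `|g.[x]| <= C) ->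
  (\int[mu \x mu]_z `|(kernel z p * weight_of g z)%:E| <= C%:E)%E.
Proof.
move=> gC.
have mw : measurable_fun [set: RR] (w : RR -> R).
  apply: continuous_measurable_fun; exact: continuous_cauchy_density.
rewrite [leLHS](integral_abs_cot_chart mf f0).
apply: (@le_trans _ _ (\int[mu]_u (C * w u)%:E)%E).
  apply: ge0_le_integral => //.
  - by move=> u _; apply: integral_ge0.
  - have mabs : measurable_fun setT (fun q : RR * RR => `|(cot_chart f q)%:E|%E).
      by apply: measurableT_comp => //; apply/measurable_EFinP; exact: measurable_cot_chart.
    have mabs0 q : (0 <= `|(cot_chart f q)%:E|)%E by exact: abse_ge0.
    exact: (measurable_fun_fubini_tonelli_F _ mabs mabs0).
  - by apply/measurable_EFinP; apply: measurable_funM => //; exact: mw.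
  - move=> u _; apply: (le_trans (int_row_abs u)).
    by rewrite lee_fin ler_wpM2r ?cauchy_density_ge0// gC// angle_of_cot01.
(* The Cauchy density has total mass 1; the splitting point 0 is arbitrary. *)
rewrite (@integral_angle_split _ _ C%:P C%:P 0).
- by rewrite subrK primpC hornerZ hornerX mulr1.
- by apply: measurable_funM => //; exact: mw.
- by move=> u _; rewrite hornerC.
- by move=> u _; rewrite hornerC.
Qed.

Lemma integral_kernel :
  (\int[mu \x mu]_z (kernel z p * weight_of g z)%:E = (branch_at g p)%:E)%E.
Proof.
rewrite [LHS](integral_cot_chart mf f0); last first.
  have [C _ gC] := horner_bounded g.
  by rewrite (le_lt_trans (integral_abs_kernel gC))// ltry.
under eq_integral do rewrite int_row angle_jump_parent//.
have p0 := pi_gt0 R; have pn := lt0r_neq0 p0.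
have kE u s : k u * (s * pi + atan u *+ 2) = ((s + 1) / 2 - tau u) * g.[tau u] * w u.
  rewrite /k; set W := w u; rewrite /angle_of_cot; set h := g.[_].
  by move: (@pi R) pn => pi' pn; field.
(* Value of the step function beyond the cotangent of [p]. For [p = (1, 0)] the sign is constantly
   1, there is no jump, and [p.1 / p.2 = 0] is a dummy splitting point. *)
pose a : R := if p.2 == 0 then 1 else 0.
have sgE u : (u < p.1 / p.2 -> (Num.sg (c1 u) + 1) / 2 = 1) /\
             (p.1 / p.2 < u -> (Num.sg (c1 u) + 1) / 2 = a).
  rewrite /c1 /a; case: p_upper => [b0|->]; last first.
    by rewrite /= mulr0 subr0 sgr1 eqxx; split => _; lra.
  rewrite (negPf (lt0r_neq0 b0)) ltr_pdivlMr// ltr_pdivrMr//; split => h.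
    rewrite gtr0_sg ?subr_gt0//; lra.
  rewrite ltr0_sg ?subr_lt0//; lra.
rewrite (@integral_angle_branch _ _ g (p.1 / p.2) a).
- congr EFin; rewrite /branch_at /weight_of /a; case: (p.2 == 0).
    by rewrite oner_eq0.
  by rewrite eqxx.
- have mk : measurable_fun setT (k : RR -> R).
    apply: measurable_funM => //; apply: continuous_measurable_fun.
    exact: continuous_horner_angle.
  have msg : measurable_fun [set: RR] (fun x : RR => Num.sg x : R).
    rewrite /Num.sg; apply: measurable_fun_ifT => //; first exact: measurable_fun_eqr.
    by apply: measurable_fun_ifT => //; exact: measurable_fun_ltr.
  apply: measurable_funM => //; apply: measurable_funD.
    apply: measurable_funM => //; apply: (measurableT_comp msg).
    by apply: measurable_funB => //; apply: measurable_funM.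
  have ma : measurable_fun [set: RR] (@atan R : RR -> R).
    by apply: continuous_measurable_fun; exact: continuous_atan.
  by under eq_fun do rewrite mulr2n; apply: measurable_funD.
- by move=> u up; rewrite kE (proj1 (sgE u)).
- by move=> u up; rewrite kE (proj2 (sgE u)).
- by rewrite /a; case: ifP; [right|left].
Qed.

End fixed_parent.
End KernelIntegral.

(** * Tuples with one coordinate inserted *)

Definition insert_tuple (T : Type) n (k : 'I_n.+1) (x : T) (w : n.-tuple T) :
  n.+1.-tuple T := [tuple if unlift k i is Some j then tnth w j else x | i < n.+1].

Lemma tnth_insert (T : Type) n (k : 'I_n.+1) (x : T) (w : n.-tuple T) :
  tnth (insert_tuple k x w) k = x.
Proof. by rewrite tnth_mktuple unlift_none. Qed.

Lemma tnth_insert_lift (T : Type) n (k : 'I_n.+1) (x : T) (w : n.-tuple T) j :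
  tnth (insert_tuple k x w) (lift k j) = tnth w j.
Proof. by rewrite tnth_mktuple liftK. Qed.

Lemma insert_tuple0 (T : Type) n (x : T) (w : n.-tuple T) :
  insert_tuple ord0 x w = [tuple of x :: w].
Proof.
apply: eq_from_tnth => i; case: (unliftP ord0 i) => [j|] ->.
  by rewrite tnth_insert_lift tnthS.
by rewrite tnth_insert tnth0.
Qed.

Lemma insert_tuple_lift0 (T : Type) n (k : 'I_n.+1) (x y : T) (w : n.-tuple T) :
  insert_tuple (lift ord0 k) y [tuple of x :: w] = [tuple of x :: insert_tuple k y w].
Proof.
apply: eq_from_tnth => i; case: (unliftP (lift ord0 k) i) => [j|] ->.
  rewrite tnth_insert_lift; case: (unliftP ord0 j) => [j'|] ->.
    have -> : lift (lift ord0 k) (lift ord0 j') = lift ord0 (lift k j').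
      by apply: val_inj; rewrite /= /bump /= !add1n ltnS addnS.
    by rewrite !tnthS tnth_insert_lift.
  have -> : lift (lift ord0 k) ord0 = ord0 by apply: val_inj.
  by rewrite !tnth0.
by rewrite tnth_insert tnthS tnth_insert.
Qed.

Section TupleMeasure.
Context d (T : measurableType d) (R : realType).
Variable mu : {sigma_finite_measure set T -> \bar R}.
Local Open Scope ereal_scope.

Lemma measurable_insert n (k : 'I_n.+1) d' (S : measurableType d')
    (f : S -> T) (h : S -> n.-tuple T) :
  measurable_fun setT f -> measurable_fun setT h ->
  measurable_fun setT (fun s => insert_tuple k (f s) (h s)).
Proof.
move=> mf mh; apply/measurable_fun_tnthP => i.
case: (unliftP k i) => [j|] ->; rewrite /comp /=.
  under eq_fun do rewrite tnth_insert_lift.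
  exact: (measurableT_comp (measurable_tnth j) mh).
by under eq_fun do rewrite tnth_insert.
Qed.

Lemma measurable_preimage d1 d2 (S1 : measurableType d1) (S2 : measurableType d2)
    (f : S1 -> S2) A : measurable_fun setT f -> measurable A -> measurable (f @^-1` A).
Proof. by move=> mf mA; rewrite -[X in measurable X]setTI; exact: mf. Qed.

(** [tuple_measure] adds coordinates at the head, whereas a leaf may have any index. The induction
    exchanges the inserted coordinate with the head by Tonelli on these two coordinates, the others
    being measured by [m]. *)
Lemma tuple_measure_insert n (k : 'I_n.+1) (A : set (n.+1.-tuple T)) :
  measurable A -> tuple_measure mu A =
  (mu \x tuple_measure mu (n := n)) [set p | A (insert_tuple k p.1 p.2)].
Proof.
elim: n k A => [|n IH] k A mA.
  rewrite [k]ord1 /= /pushforward; congr (product_measure1 _ _ _).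
  by apply/seteqP; split => p /=; rewrite insert_tuple0.
case: (unliftP ord0 k) => [k'|] ->; last first.
  rewrite [LHS]/= /pushforward; congr (product_measure1 _ _ _).
  by apply/seteqP; split => p /=; rewrite insert_tuple0.
have [m em _] := tuple_measureP mu n.
pose B : set ((T * T) * n.-tuple T) :=
  [set q | A [tuple of q.1.1 :: insert_tuple k' q.1.2 q.2]].
have mB : measurable B.
  apply: (@measurable_preimage _ _ _ _ (fun q => [tuple of q.1.1 :: insert_tuple k' q.1.2 q.2])) => //.
  apply: measurable_cons.
    exact: (measurableT_comp (measurable_fst) (measurable_fst)).
  apply: measurable_insert; last exact: measurable_snd.
  exact: (measurableT_comp (measurable_snd) (measurable_fst)).
have := @fubini_tonelli _ _ _ _ R mu mu (fun q => m (xsection B q))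
  (measurable_fun_xsection m mB) (fun q => measure_ge0 _ _).
have E1 : tuple_measure mu A = \int[mu]_x \int[mu]_y m (xsection B (x, y)).
  rewrite [LHS]/= /pushforward [LHS]/product_measure1 /=.
  apply: eq_integral => x _; set S := xsection _ x.
  rewrite -[LHS]/(tuple_measure mu (n := n.+1) S) /S.
  rewrite (IH k') ?em.
    rewrite /product_measure1; apply: eq_integral => y _ /=; congr (m _).
    by rewrite !xsectionE.
  rewrite xsectionE; apply: measurable_preimage; last first.
    apply: (@measurable_preimage _ _ _ _ (fun q : T * n.+1.-tuple T => [tuple of q.1 :: q.2])) mA.
    by apply: measurable_cons; [exact: measurable_fst|exact: measurable_snd].
  exact: pair1_measurable.
have E2 : (mu \x tuple_measure mu (n := n.+1))
    [set p | A (insert_tuple (lift ord0 k') p.1 p.2)] =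
    \int[mu]_y \int[mu]_x m (xsection B (x, y)).
  rewrite [LHS]/product_measure1; apply: eq_integral => y _ /=.
  rewrite /pushforward em /product_measure1; apply: eq_integral => x _ /=.
  congr (m _); rewrite !xsectionE; apply/seteqP.
  by split => w /=; rewrite insert_tuple_lift0.
by rewrite E1 E2.
Qed.

Variables (n : nat) (m : {sigma_finite_measure set (n.-tuple T) -> \bar R}).
Hypothesis em : tuple_measure mu (n := n) = m.

Let ins k (p : T * n.-tuple T) := insert_tuple k p.1 p.2.

Let mins k : measurable_fun setT (ins k).
Proof. by apply: measurable_insert; [exact: measurable_fst|exact: measurable_snd]. Qed.

Let pm k := measure_function_pushforward__canonical__measure_function_Measure (mu \x m) (mins k).

Lemma integral_tuple_pushforward k (f : n.+1.-tuple T -> \bar R) :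
  \int[tuple_measure mu (n := n.+1)]_z f z = \int[pushforward (mu \x m) (ins k)]_z f z.
Proof.
have [m' em' _] := tuple_measureP mu n.+1.
rewrite em'; transitivity (\int[pm k]_z f z) => //.
apply: eq_measure_integral => A mA _.
transitivity (tuple_measure mu A); first by rewrite em'.
by rewrite (tuple_measure_insert k mA) em.
Qed.

Lemma ge0_integral_insert k (f : n.+1.-tuple T -> \bar R) :
  measurable_fun setT f -> (forall z, 0 <= f z) ->
  \int[tuple_measure mu (n := n.+1)]_z f z =
  \int[m]_w \int[mu]_x f (insert_tuple k x w).
Proof.
move=> mf f0; rewrite (integral_tuple_pushforward k).
rewrite ge0_integral_pushforward//.
rewrite preimage_setT fubini_tonelli2//; first exact: measurableT_comp.
by move=> x; exact: f0.
Qed.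

Lemma integral_insert k (f : n.+1.-tuple T -> \bar R) :
  measurable_fun setT f ->
  \int[tuple_measure mu (n := n.+1)]_z `|f z| < +oo ->
  \int[tuple_measure mu (n := n.+1)]_z f z =
  \int[m]_w \int[mu]_x f (insert_tuple k x w).
Proof.
move=> mf foo.
have fi : (mu \x m).-integrable setT (f \o ins k).
  apply/integrableP; split; first exact: measurableT_comp.
  have mfi : measurable_fun setT (f \o ins k) by exact: measurableT_comp.
  rewrite fubini_tonelli2//; last exact: measurableT_comp.
  have maf : measurable_fun setT (abse \o f) by exact: measurableT_comp.
  have := ge0_integral_insert k maf (fun z => abse_ge0 _).
  by move=> /= <-.
rewrite (integral_tuple_pushforward k) integral_pushforward//.
by rewrite preimage_setT -(integral21_prod_meas1 fi).
Qed.

End TupleMeasure.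

(** * Integration over a forest *)

(* The library keys its canonical instance on products of subprobabilities only. *)
Lemma product_sigma_finite d1 d2 (T1 : measurableType d1) (T2 : measurableType d2)
    (R : realType) (m1 : {sigma_finite_measure set T1 -> \bar R})
    (m2 : {sigma_finite_measure set T2 -> \bar R}) : sigma_finite setT (m1 \x m2)%E.
Proof.
exact: isSigmaFinite.sigma_finiteT
  (lebesgue_integral_fubini.measure_function_Measure_isSigmaFinite__to__measure_function_isSigmaFinite m1 m2).
Qed.

Section Forest.
Variable R : realType.
Local Notation mu := (@lebesgue_measure R).
Local Notation RR := (measurableTypeR R).

Definition plane_measure : {sigma_finite_measure set (RR * RR)%type -> \bar R} :=
  HB.pack (mu \x mu)%E (Measure_isSigmaFinite.Build _ _ _ _ (product_sigma_finite mu mu)).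

Definition forest_density n (par : 'I_n -> option 'I_n) (g : 'I_n -> {poly R})
    (z : config R n) : R :=
  \prod_k (kernel (tnth z k) (parent_point par z k) * weight_of (g k) (tnth z k)).

Lemma measurable_forest_density n par g :
  measurable_fun setT (@forest_density n par g : n.-tuple (RR * RR)%type -> R).
Proof.
have m1 k : measurable_fun setT (fun z : n.-tuple (RR * RR)%type => (tnth z k).1 : RR).
  exact: (measurableT_comp measurable_fst (measurable_tnth k)).
have m2 k : measurable_fun setT (fun z : n.-tuple (RR * RR)%type => (tnth z k).2 : RR).
  exact: (measurableT_comp measurable_snd (measurable_tnth k)).
apply: measurable_prod => k _; apply: measurable_funM.
  by apply: measurable_kernel; [exact: m1|exact: m2|..]; rewrite /parent_point;
    case: (par k) => [j|] //; [exact: m1|exact: m2].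
by apply: measurable_weight_of; [exact: m1|exact: m2].
Qed.

(** Acyclicity in a form that survives the removal and renumbering of vertices. *)
Definition graded_forest n (par : 'I_n -> option 'I_n) (d : 'I_n -> nat) :=
  forall k j, par k = Some j -> (d j < d k)%N.

(** For general [k], [unlift k] would turn the children of [k] into roots; when [k] is a leaf no
    edge is lost. *)
Definition remove_leaf n (k : 'I_n.+1) (par : 'I_n.+1 -> option 'I_n.+1)
  (i : 'I_n) : option 'I_n := obind (unlift k) (par (lift k i)).

Lemma forest_leaf n (par : 'I_n.+1 -> option 'I_n.+1) d : graded_forest par d ->
  exists k, forall i, par i != Some k.
Proof.
move=> dP; case: (arg_maxnP d (erefl : xpredT ord0)) => k _ dk.
exists k => i; apply/eqP => /dP; rewrite ltnNge; move/negP; apply.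
exact: dk.
Qed.

Section leaf.
Variables (n : nat) (par : 'I_n.+1 -> option 'I_n.+1) (k : 'I_n.+1).
Hypothesis leaf_k : forall i, par i != Some k.
Variable g : 'I_n.+1 -> {poly R}.

Lemma remove_leafE i j : (remove_leaf k par i == Some j) = (par (lift k i) == Some (lift k j)).
Proof.
rewrite /remove_leaf; case pi : (par (lift k i)) => [l|]//=.
have : l != k by apply: contraNneq (leaf_k (lift k i)) => lk; rewrite pi lk.
case: (unliftP k l) => [l'|] ->; last by rewrite eqxx.
by move=> _; rewrite !(inj_eq Some_inj) (inj_eq lift_inj).
Qed.

Lemma remove_leaf_None i : (remove_leaf k par i == None) = (par (lift k i) == None).
Proof.
rewrite /remove_leaf; case pi : (par (lift k i)) => [l|]//=.
have : l != k by apply: contraNneq (leaf_k (lift k i)) => lk; rewrite pi lk.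
by case: (unliftP k l) => [l'|] ->; last rewrite eqxx.
Qed.

Lemma graded_remove_leaf d : graded_forest par d ->
  graded_forest (remove_leaf k par) (fun i => d (lift k i)).
Proof. by move=> dP i j /eqP; rewrite remove_leafE => /eqP /dP. Qed.

Lemma parent_point_insert x (w : config R n) i :
  parent_point par (insert_tuple k x w) (lift k i) = parent_point (remove_leaf k par) w i.
Proof.
rewrite /parent_point /remove_leaf; case pi : (par (lift k i)) => [l|]//=.
have : l != k by apply: contraNneq (leaf_k (lift k i)) => lk; rewrite pi lk.
case: (unliftP k l) => [l'|] ->; last by rewrite eqxx.
by rewrite tnth_insert_lift.
Qed.

Definition leaf_parent (w : config R n) : R * R :=
  if obind (unlift k) (par k) is Some j then tnth w j else (1, 0).

Lemma parent_point_leaf x (w : config R n) :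
  parent_point par (insert_tuple k x w) k = leaf_parent w.
Proof.
rewrite /parent_point /leaf_parent; case pk : (par k) => [l|]//=.
have : l != k by apply: contraNneq (leaf_k k) => lk; rewrite pk lk.
case: (unliftP k l) => [l'|] ->; last by rewrite eqxx.
by rewrite tnth_insert_lift.
Qed.

Lemma forest_density_insert x (w : config R n) :
  forest_density par g (insert_tuple k x w) =
  forest_density (remove_leaf k par) (fun i => g (lift k i)) w *
  (kernel x (leaf_parent w) * weight_of (g k) x).
Proof.
rewrite /forest_density (bigD1_ord k)//= tnth_insert parent_point_leaf mulrC.
congr (_ * _); apply: eq_bigr => i _.
by rewrite tnth_insert_lift parent_point_insert.
Qed.

(** Since [kernel] vanishes off the upper half-plane, a nonzero density plays the role of a domain
    of integration. *)
Lemma forest_density_upper (par' : 'I_n -> option 'I_n) g' (w : config R n) i :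
  forest_density par' g' w != 0 -> 0 < (tnth w i).2.
Proof.
move/prodf_neq0/(_ i isT); apply: contraNT => jn.
by rewrite /kernel (negPf jn) mul0r.
Qed.

Lemma leaf_parent_upper (par' : 'I_n -> option 'I_n) g' (w : config R n) :
  forest_density par' g' w != 0 -> 0 < (leaf_parent w).2 \/ leaf_parent w = (1, 0).
Proof.
rewrite /leaf_parent => h; case: (obind _ _) => [j|]; [left|by right].
exact: forest_density_upper h.
Qed.

Let g' i := g (lift k i) * (if par k == Some (lift k i) then branch (g k) else 1).

Lemma weight_ofM (p q : {poly R}) z : weight_of (p * q) z = weight_of p z * weight_of q z.
Proof. by rewrite /weight_of hornerM. Qed.

Lemma weight_of1 z : weight_of (1 : {poly R}) z = 1.
Proof. by rewrite /weight_of hornerC. Qed.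

(** A nonzero [F] puts the parent of the leaf in the upper half-plane, which selects the case of
    [branch_at]: either a weight for the parent, or a constant if the leaf is itself a root. *)
Lemma forest_density_leaf (w : config R n) :
  let F := forest_density (remove_leaf k par) (fun i => g (lift k i)) w in
  F != 0 ->
  F * branch_at (g k) (leaf_parent w) =
  forest_density (remove_leaf k par) g' w * (if par k == None then (branch (g k)).[0] else 1).
Proof.
move=> F F0; have upper i := forest_density_upper i F0.
have -> : forest_density (remove_leaf k par) g' w =
    F * \prod_i (if par k == Some (lift k i) then weight_of (branch (g k)) (tnth w i) else 1).
  rewrite /F /forest_density -big_split; apply: eq_bigr => i _ /=.
  by rewrite weight_ofM mulrA; case: ifP => // _; rewrite weight_of1.
rewrite -mulrA; congr (_ * _); rewrite /branch_at /leaf_parent.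
case pk : (par k) => [l|] /=; last first.
  by rewrite eqxx big1 ?mul1r.
have : l != k by apply: contraNneq (leaf_k k) => lk; rewrite pk lk.
case: (unliftP k l) => [j|] ->; last by rewrite eqxx.
rewrite /= mulr1 => _.
rewrite (bigD1 j)//= eqxx big1 ?mulr1; last first.
  by move=> i ij; rewrite (inj_eq Some_inj) (inj_eq lift_inj) eq_sym (negPf ij).
by rewrite (gt_eqF (upper j)).
Qed.

Lemma integral_abs_leaf (C : R) (w : config R n) :
  (forall x, 0 <= x <= 1 -> `|(g k).[x]| <= C) ->
  (\int[plane_measure]_x `|(forest_density par g (insert_tuple k x w))%:E| <=
   C%:E * `|(forest_density (remove_leaf k par) (fun i => g (lift k i)) w)%:E|)%E.
Proof.
move=> gC; set F := forest_density _ (fun _ => _) w.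
have [F0|F0] := eqVneq F 0.
  rewrite F0 abse0 mule0 integral0_eq// => x _.
  by rewrite forest_density_insert -/F F0 mul0r abse0.
under eq_integral do rewrite forest_density_insert -/F EFinM abseM.
have mK : measurable_fun setT (fun x : (RR * RR)%type =>
    `|(kernel x (leaf_parent w) * weight_of (g k) x)%:E|%E).
  apply: measurableT_comp => //; apply/measurable_EFinP; apply: measurable_funM.
    by apply: measurable_kernel => //; [exact: measurable_fst|exact: measurable_snd].
  by apply: measurable_weight_of; [exact: measurable_fst|exact: measurable_snd].
rewrite ge0_integralZl//.
rewrite muleC lee_wpmul2r//.
exact: (integral_abs_kernel _ gC).
Qed.

Lemma integral_leaf (w : config R n) :
  (\int[plane_measure]_x (forest_density par g (insert_tuple k x w))%:E =
   (forest_density (remove_leaf k par) g' w *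
     (if par k == None then (branch (g k)).[0] else 1))%:E)%E.
Proof.
set F := forest_density (remove_leaf k par) (fun i => g (lift k i)) w.
have [F0|F0] := eqVneq F 0.
  rewrite integral0_eq; last first.
    by move=> x _; rewrite forest_density_insert -/F F0 mul0r.
  (* When [F = 0] the parent may lie off the half-plane, out of reach of [integral_kernel]. But a
     vanishing factor of [F] persists when [g'] multiplies its weight. *)
  have [i Fi] : exists i, kernel (tnth w i) (parent_point (remove_leaf k par) w i) *
      weight_of (g (lift k i)) (tnth w i) = 0.
    by move/eqP : F0 => /prodf_eq0[i _ /eqP Fi]; exists i.
  rewrite /forest_density (bigD1 i)//= weight_ofM mulrA Fi !mul0r.
  by [].
under eq_integral do rewrite forest_density_insert -/F EFinM.
rewrite -(forest_density_leaf F0) -/F EFinM -(@integral_kernel R (g k) _ (leaf_parent_upper F0)).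
rewrite integralZl//; apply/integrableP; split.
  apply/measurable_EFinP; apply: measurable_funM.
    by apply: measurable_kernel => //; [exact: measurable_fst|exact: measurable_snd].
  by apply: measurable_weight_of; [exact: measurable_fst|exact: measurable_snd].
have [C _ gC] := horner_bounded (g k).
by rewrite (le_lt_trans (integral_abs_kernel _ gC))// ltry.
Qed.

End leaf.

(* A vertex of maximal depth is a leaf; integrating it out multiplies the weight
   of its parent by [branch]. *)
Theorem integral_forest n (par : 'I_n -> option 'I_n) d (g : 'I_n -> {poly R}) :
  graded_forest par d ->
  (\int[tuple_measure plane_measure (n := n)]_z `|(forest_density par g z)%:E| < +oo)%E /\
  exists2 Q : 'I_n -> {poly R},
    forall k, Q k = branch (g k * \prod_(c | par c == Some k) Q c) &
    (\int[tuple_measure plane_measure (n := n)]_z (forest_density par g z)%:E =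
      (\prod_(k | par k == None) (Q k).[0])%:E)%E.
Proof.
elim: n par d g => [|n IH] par d g dP.
  have F1 z : forest_density par g z = 1 by rewrite /forest_density big_ord0.
  have [m em mA] := tuple_measureP plane_measure 0.
  have mT : m setT = 1%E.
    have := mA (fun=> setT) (fun=> measurableT); rewrite big_ord0 => <-.
    by congr (m _); apply/seteqP; split.
  rewrite em; split.
    under eq_integral do rewrite F1.
    by rewrite integral_cst// [X in (_ * X)%E]mT mule1 /= normr1 ltry.
  exists (fun=> 0) => [[]//|].
  under eq_integral do rewrite F1.
  by rewrite integral_cst// [X in (_ * X)%E]mT mule1 big_ord0.
have [m em _] := tuple_measureP plane_measure n.
have [k leaf_k] := forest_leaf dP.
have d'P := graded_remove_leaf leaf_k dP.
pose g' i := g (lift k i) * (if par k == Some (lift k i) then branch (g k) else 1).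
(* Two uses of the induction hypothesis: the unchanged weights give the integrable bound of
   [integral_abs_leaf], the weights [g'] give the value. *)
have [F0oo _] := IH _ _ (fun i => g (lift k i)) d'P.
have [F'oo [Q' QE intE]] := IH _ _ g' d'P.
rewrite em in F0oo F'oo intE.
have mF : measurable_fun setT (fun z : n.+1.-tuple (RR * RR)%type =>
    (forest_density par g z)%:E).
  by apply/measurable_EFinP; exact: measurable_forest_density.
have maF : measurable_fun setT (fun z : n.+1.-tuple (RR * RR)%type =>
    `|(forest_density par g z)%:E|%E).
  exact: measurableT_comp.
have abs_oo : (\int[tuple_measure plane_measure (n := n.+1)]_z `|(forest_density par g z)%:E| < +oo)%E.
  have [C C0 gC] := horner_bounded (g k).
  rewrite (ge0_integral_insert em k maF)//.
  have mF0 : measurable_fun setT (fun w : n.-tuple (RR * RR)%type =>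
      `|(forest_density (remove_leaf k par) (fun i => g (lift k i)) w)%:E|%E).
    by apply: measurableT_comp => //; apply/measurable_EFinP; exact: measurable_forest_density.
  apply: (@le_lt_trans _ _ (\int[m]_w (C%:E *
      `|(forest_density (remove_leaf k par) (fun i => g (lift k i)) w)%:E|))%E).
    have mins : measurable_fun setT (fun p : ((RR * RR) * n.-tuple (RR * RR))%type =>
        `|(forest_density par g (insert_tuple k p.1 p.2))%:E|%E).
      apply: (measurableT_comp maF).
      by apply: measurable_insert; [exact: measurable_fst|exact: measurable_snd].
    apply: ge0_le_integral => //.
    - by move=> w _; apply: integral_ge0.
    - exact: (measurable_fun_fubini_tonelli_G (m1 := plane_measure) _ mins (fun=> abse_ge0 _)).
    - exact: measurable_funeM.
    - by move=> w _; exact: integral_abs_leaf.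
  rewrite ge0_integralZl//.
  exact: lte_mul_pinfty.
split => //.
pose Q i := if unlift k i is Some i' then Q' i' else branch (g k).
have Qk : Q k = branch (g k) by rewrite /Q unlift_none.
have Ql i : Q (lift k i) = Q' i by rewrite /Q liftK.
exists Q.
  move=> i; case: (unliftP k i) => [j|] ->.
    rewrite Ql QE; congr branch.
    rewrite /g' -mulrA; congr (_ * _).
    rewrite [RHS]big_mkcond (bigD1_ord k)//= Qk; congr (_ * _).
    rewrite big_mkcond; apply: eq_bigr => c _.
    by rewrite Ql remove_leafE.
  by rewrite Qk big1 ?mulr1// => c; rewrite (negPf (leaf_k c)).
rewrite (integral_insert em k mF)//.
under eq_integral do rewrite (integral_leaf leaf_k) EFinM.
rewrite integralZr//; last first.
  apply/integrableP; split => //.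
  by apply/measurable_EFinP; exact: measurable_forest_density.
rewrite intE -EFinM; congr EFin.
rewrite [RHS]big_mkcond (bigD1_ord k)//= Qk mulrC; congr (_ * _).
rewrite big_mkcond; apply: eq_bigr => c _.
by rewrite Ql remove_leaf_None.
Qed.

End Forest.

(** * Configurations *)

(** The grading is the depth, the least number of parent steps leading to the root. *)
Lemma rooted_tree_graded n (par : 'I_n -> option 'I_n) r :
  rooted_tree par r -> exists d, graded_forest par d.
Proof.
move=> [rN reach].
have reachb k : exists m, iter m (obind par) (Some k) == Some r.
  by have [m mk] := reach k; exists m; apply/eqP.
exists (fun k => ex_minn (reachb k)) => k j kj.
case: (ex_minnP (reachb k)) => [[|m]].
  by move=> /eqP[kr]; rewrite -kr kj in rN.
rewrite iterSr /= kj => jm _; rewrite ltnS.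
by case: (ex_minnP (reachb j)) => m' _; apply.
Qed.

Lemma rooted_tree_root n (par : 'I_n -> option 'I_n) r k :
  rooted_tree par r -> (par k == None) = (k == r).
Proof.
move=> [rN reach]; apply/eqP/eqP => [kN|->//].
have [[|m]] := reach k; first by case.
rewrite iterSr /= kN; suff -> : iter m (obind par) None = None by [].
by elim: m => //= m ->.
Qed.

(** * Collisions of points are negligible *)

Section Diagonals.
Variable R : realType.
Local Notation RR := (measurableTypeR R).
Local Notation plane := (plane_measure R).

Lemma plane_measure_set1 (p : R * R) : plane [set p] = 0%E.
Proof.
have -> : [set p] = [set p.1] `*` [set p.2].
  by case: p => a b; apply/seteqP; split => [[x y] [-> ->]|[x y] /= [-> ->]].
rewrite /= product_measure1E//.
by rewrite [X in (X * _)%E]lebesgue_measure_set1 mul0e.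
Qed.

Definition diagonal n (i j : 'I_n) : set (n.-tuple (RR * RR)%type) :=
  [set z | tnth z i = tnth z j].

Lemma measurable_coord n (i : 'I_n) :
  measurable_fun setT (fun z : n.-tuple (RR * RR)%type => (tnth z i).1 : RR) /\
  measurable_fun setT (fun z : n.-tuple (RR * RR)%type => (tnth z i).2 : RR).
Proof.
by split; [apply: (measurableT_comp measurable_fst)|apply: (measurableT_comp measurable_snd)];
  exact: measurable_tnth.
Qed.

Lemma measurable_diagonal n (i j : 'I_n) : measurable (diagonal i j).
Proof.
have [xi yi] := measurable_coord i; have [xj yj] := measurable_coord j.
pose b (z : n.-tuple (RR * RR)%type) :=
  ((tnth z i).1 == (tnth z j).1) && ((tnth z i).2 == (tnth z j).2).
have mb : measurable_fun setT b.
  by apply: measurable_and; exact: measurable_fun_eqr.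
rewrite (_ : diagonal i j = b @^-1` [set true]).
  exact: (measurable_preimage mb).
apply/seteqP; split => z; rewrite /diagonal /b /=; first by move=> ->; rewrite !eqxx.
by case: (tnth z i) (tnth z j) => ? ? [? ?] /= /andP[/eqP -> /eqP ->].
Qed.

(** With coordinate [i] integrated out first, each slice of the diagonal is a single point of the
    plane. *)
Lemma tuple_measure_diagonal n (i j : 'I_n) : i != j ->
  tuple_measure plane (diagonal i j) = 0%E.
Proof.
case: n i j => [[]//|n] i j ij.
have [m em _] := tuple_measureP plane n.
have [m' em' _] := tuple_measureP plane n.+1.
have mD := measurable_diagonal i j.
transitivity (\int[tuple_measure plane (n := n.+1)]_z (\1_(diagonal i j) z)%:E)%E.
  by rewrite em' integral_indic// setIT.
rewrite (ge0_integral_insert em i); last 2 first.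
- by apply/measurable_EFinP; exact: measurable_indic.
- by move=> z; rewrite lee_fin.
rewrite integral0_eq// => w _.
case: (unliftP i j) ij => [j'|] -> ij; last by rewrite eqxx in ij.
rewrite -(plane_measure_set1 (tnth w j')).
transitivity (\int[plane]_x (\1_[set tnth w j'] x)%:E)%E.
  apply: eq_integral => x _; rewrite !indicE; congr ((nat_of_bool _)%:R%:E).
  by apply/idP/idP; rewrite !inE /diagonal /= tnth_insert tnth_insert_lift.
rewrite integral_indic ?setIT//.
have -> : [set tnth w j'] = [set (tnth w j').1] `*` [set (tnth w j').2].
  by case: (tnth w j') => a b; apply/seteqP; split => [[x y] [-> ->]|[x y] /= [-> ->]].
exact: measurableX.
Qed.

End Diagonals.

Section Configurations.
Variables (R : realType) (n : nat).
Local Notation RR := (measurableTypeR R).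
Local Notation config' := (n.-tuple (RR * RR)%type).

Let collide : {pred 'I_n * 'I_n} := [pred p | p.1 != p.2].

Definition collisions : set config' :=
  \big[setU/set0]_(p in collide) diagonal p.1 p.2.

Lemma collisionsP (z : config') :
  ~ collisions z <-> injective (fun i => tnth z i).
Proof.
rewrite /collisions -bigcup_pred; split=> [nc i j ij|inj [[i j] /=]].
  by apply/eqP/negPn/negP => nij; apply: nc; exists (i, j).
by rewrite inE /= => nij /inj /eqP; rewrite (negPf nij).
Qed.

Lemma measurable_collisions : measurable collisions.
Proof. by apply: bigsetU_measurable => p _; exact: measurable_diagonal. Qed.

Lemma tuple_measure_collisions : tuple_measure (plane_measure R) collisions = 0%E.
Proof.
have [m em _] := tuple_measureP (plane_measure R) n.
rewrite em; apply/negligibleP; first exact: measurable_collisions.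
rewrite /collisions; elim/big_ind : _ => //.
- exact: negligible_set0.
- by move=> A B; exact: negligibleU.
- move=> p pp; apply/negligibleP; first exact: measurable_diagonal.
  by transitivity (tuple_measure (plane_measure R) (diagonal p.1 p.2));
    rewrite ?em// -em tuple_measure_diagonal.
Qed.

Lemma conf_spaceE :
  @conf_space R n = [set z : config' | forall k, 0 < (tnth z k).2] `\` collisions.
Proof.
apply/seteqP; split => z [zpos].
  move=> zinj; split => //; apply/collisionsP => i j ij; apply: zinj.
  by rewrite /zpoint ij.
move=> /collisionsP zinj; split => // i j [e1 e2]; apply: zinj.
by rewrite [tnth z i]surjective_pairing e1 e2 -surjective_pairing.
Qed.

Lemma measurable_conf_space : measurable (@conf_space R n : set config').
Proof.
rewrite conf_spaceE; apply: measurableD; last exact: measurable_collisions.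
have -> : [set z : config' | forall k, 0 < (tnth z k).2] =
    \bigcap_(k in [set: 'I_n]) ((fun z => 0 < (tnth z k).2) @^-1` [set true]).
  by apply/seteqP; split => [z h k _|z h k]; [exact: h|exact: (h k I)].
apply: fin_bigcap_measurable; first exact: finite_finset.
move=> k _; have [_ yk] := @measurable_coord R n k.
have mb : measurable_fun setT (fun z : config' => 0 < (tnth z k).2).
  exact: measurable_fun_ltr.
exact: (measurable_preimage mb).
Qed.

(* [R] and [measurableTypeR R] are the same measurable space under two
   different displays. *)
Lemma measurable_display :
  measurable_fun [set: config R n] (id : config R n -> config') /\
  measurable_fun [set: config'] (id : config' -> config R n).
Proof.
have mR : measurable_fun [set: R] (id : R -> RR) by move=> _ A mA; rewrite setTI.
have mRR : measurable_fun [set: RR] (id : RR -> R) by move=> _ A mA; rewrite setTI.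
split; apply/measurable_fun_tnthP => i; apply/measurable_fun_pairP; split.
- apply: (measurableT_comp mR).
  exact: (measurableT_comp measurable_fst (measurable_tnth i)).
- apply: (measurableT_comp mR).
  exact: (measurableT_comp measurable_snd (measurable_tnth i)).
- apply: (measurableT_comp mRR).
  exact: (measurableT_comp measurable_fst (measurable_tnth i)).
- apply: (measurableT_comp mRR).
  exact: (measurableT_comp measurable_snd (measurable_tnth i)).
Qed.

(* The form vanishes off the upper half plane and the collisions are negligible. *)
Lemma integral_conf_space (G : config R n -> R) (F : config' -> R) :
  (forall z, conf_space z -> G z = F z) -> measurable_fun setT F ->
  (forall z i, (tnth z i).2 <= 0 -> F z = 0) ->
  (\int[tuple_measure (plane_measure R) (n := n)]_z `|(F z)%:E| < +oo)%E ->
  (\int[@lebesgue_config R n]_(z in @conf_space R n) (G z)%:E =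
   \int[tuple_measure (plane_measure R) (n := n)]_z (F z)%:E)%E.
Proof.
move=> GF mF F0 Foo; have [to_ from] := measurable_display.
have [m em _] := tuple_measureP (plane_measure R) n.
have mFE : measurable_fun setT (EFin \o F) by exact/measurable_EFinP.
have iF : m.-integrable setT (EFin \o F).
  by apply/integrableP; split => //; rewrite -em.
have iFc : m.-integrable (@conf_space R n : set config') (EFin \o F).
  by apply: integrableS iF => //; exact: measurable_conf_space.
(* The measure [m] transported by the identity to the display used in [lebesgue_config]. *)
pose m' : {measure set (config R n) -> \bar R} :=
  measure_function_pushforward__canonical__measure_function_Measure m from.
transitivity (\int[m']_(z in @conf_space R n) (G z)%:E)%E.
  congr (integral _ _ _).
  by rewrite /m' /= /pushforward -em.
transitivity (\int[m']_(z in @conf_space R n) (F z)%:E)%E.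
  by apply: eq_integral => z; rewrite inE => /GF ->.
rewrite (integral_pushforward from (f := EFin \o F)); last 3 first.
- exact: (measurableT_comp mFE to_).
- exact: iFc.
- exact: (measurable_preimage to_ measurable_conf_space).
rewrite em [RHS](negligible_integral measurable_collisions)//; last first.
  by rewrite -tuple_measure_collisions em.
rewrite integral_mkcond [RHS]integral_mkcond; apply: eq_integral => z _.
rewrite !patchE preimage_id setTD; case: ifPn => [/set_mem zc|/negP zc].
  by rewrite mem_set//; move: zc; rewrite conf_spaceE => -[].
case: ifPn => // /set_mem nz; congr EFin.
have [i zi] : exists i, (tnth z i).2 <= 0.
  apply: contrapT => npos; apply: zc; rewrite inE conf_spaceE; split => // k /=.
  by rewrite ltNge; apply/negP => zk; apply: npos; exists k.
exact/esym/F0/zi.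
Qed.

End Configurations.

Theorem proposition28 (R : realType) (t : rtree) (n : nat)
    (par : 'I_n -> option 'I_n) (r : 'I_n) :
  rooted_tree par r -> has_shape par r t ->
  weight R (ktree par) = (tree_int t (0 : R))%:E.
Proof.
move=> tr sh; have [d dP] := rooted_tree_graded tr.
(* With all weights equal to 1, [forest_density] is the coefficient of the form on
   configurations. *)
have [Foo [Q QE intE]] := @integral_forest R n par d (fun=> 1) dP.
have -> : tree_int t (0 : R) = (Q r).[0].
  have QE1 k : Q k = branch (\prod_(c | par c == Some k) Q c) by rewrite {1}QE mul1r.
  by rewrite (tree_int_horner QE1 sh).
have <- : \prod_(k | par k == None) (Q k).[0] = (Q r).[0].
  by rewrite (eq_bigl _ _ (fun k => rooted_tree_root k tr)) big_pred1_eq.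
rewrite -intE; apply: integral_conf_space => //.
- move=> z zc; rewrite (omega_ktree dP zc).
  by apply: eq_bigr => k _; rewrite weight_of1 mulr1.
- exact: measurable_forest_density.
- by move=> z i zi; apply/eqP; apply: contraTT zi; rewrite -ltNge; exact: forest_density_upper.
Qed.
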